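(* Let $X$ be a complex projective variety and let $D$ be an effective Cartier divisor on $X$. If $X\setminus D$ is hyperbolically imbedded in $X$, then $X\setminus D$ is quantitatively big Picard.
   Context: ''Hyperbolically imbedded'' is in the standard sense of Kobayashi: $X\setminus D$ is Kobayashi hyperbolic and for any two distinct points $p,q$ of the closure of $X\setminus D$ in $X$ there are neighborhoods $U_p,U_q$ in $X$ such that the Kobayashi distance on $X\setminus D$ between $U_p\setminus D$ and $U_q\setminus D$ is positive. For $r_0\ge 1$ let $\overline{\bigtriangleup(r_0)}=\{z\in\mathbb{C}: |z|\le r_0\}$. For a holomorphic map $f:\mathbb{C}-\overline{\bigtriangleup(r_0)}\to X$, a positive $(1,1)$-form $\eta$ on $X$ and fixed $r_1>r_0$, set $$T_{f,\eta}(r,r_1)=\int_{r_1}^r\left(\int_{r_1<|z|<t} f^*\eta\right)\frac{dt}{t}.$$ The notation $\leq_{\mathrm{exc}}$ means that the inequality holds for all $r$ outside a set of finite measure. A holomorphic map $f:\mathbb{C}-\overline{\bigtriangleup(r_0)}\to X\setminus D$ has the quantitative big Picard property if there exists a positive $(1,1)$-form $\eta$ on $X$ such that, for a fixed $r_1>r_0$, $T_{f,\eta}(r,r_1)\leq_{\mathrm{exc}} O(\log r)$. One says that $X\setminus D$ is quantitatively big Picard if every holomorphic map $f:\mathbb{C}-\overline{\bigtriangleup(r_0)}\to X\setminus D$ has the quantitative big Picard property. The implied constants may depend on $f$. *)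

(* Defs.v *)
(* MathComp-Analysis over an abstract [R : realType]; the complex numbers are
   [R[i]] from mathcomp-real-closed. *)
From HB Require Import structures.
From mathcomp Require Import all_boot all_order all_algebra.
From mathcomp Require Import all_classical all_reals all_analysis.
From mathcomp.real_closed Require Import complex.
From mathcomp Require mpoly.
Import (canonicals, coercions) mpoly.

Set Implicit Arguments.
Unset Strict Implicit.
Unset Printing Implicit Defensive.

Import Order.TTheory GRing.Theory Num.Theory.
Import numFieldNormedType.Exports.

Local Open Scope classical_set_scope.
Local Open Scope complex_scope.
Local Open Scope ring_scope.

(* [R[i]] typed as a [numClosedFieldType], so that the normed-module structure
   (topology, complex derivatives) of MathComp-Analysis is inferred on it. *)
Definition Cplx (R : realType) : numClosedFieldType := R[i].

(* The modulus as an element of [R]; the library norm on [R[i]] is valued in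
   [R[i]]. *)
Definition cmod (R : realType) (z : Cplx R) : R := complex.Re `|z|.

Section ProjectiveSpace.
Variables (R : realType) (N : nat).
Local Notation C := (Cplx R).
Local Notation V := 'rV[C]_N.+1.

Definition punctured := set_type [set v : V | v != 0].

Definition proportional : rel punctured :=
  fun u v => (set_val u == set_val v)%MS.

Lemma proportional_refl : reflexive proportional.
Proof. by move=> u; rewrite /proportional submx_refl. Qed.

Lemma proportional_sym : symmetric proportional.
Proof. by move=> u v; rewrite /proportional andbC. Qed.

Lemma proportional_trans : transitive proportional.
Proof.
move=> v u w; rewrite /proportional => /andP[uv vu] /andP[vw wv].
by rewrite (submx_trans uv vw) (submx_trans wv vu).
Qed.

Canonical proportional_equiv :=
  EquivRel proportional proportional_refl proportional_sym proportional_trans.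

(* The complex projective space P^N = (C^(N+1) \ 0) / C^*, with the quotient of
   the Euclidean topology. *)
Definition Pn : topologicalType :=
  quotient_topology {eq_quot proportional_equiv}%qT.

(* A chosen vector of homogeneous coordinates of a point. *)
Definition homog (p : Pn) : V := set_val (repr p : punctured).

(* [coords v p]: v is a (nonzero) vector of homogeneous coordinates of p. *)
Definition coords (v : V) (p : Pn) : bool := (v == homog p)%MS.

Definition cone (U : set Pn) : set V :=
  [set v | exists2 p, U p & coords v p].

Local Notation poly := (mpoly.mpoly N.+1 C).

Definition homogeneous (d : nat) (P : poly) : Prop :=
  P \is mpoly.ishomog1 d mpoly.mdeg.

Definition peval (P : poly) (v : V) : C := mpoly.meval (fun i => v 0 i) P.

Definition zero_locus (S : set poly) : set Pn :=
  [set p | forall P, S P -> peval P (homog p) = 0].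

Definition algebraic (A : set Pn) : Prop :=
  exists2 S : set poly,
    (forall P, S P -> exists d, homogeneous d P) & A = zero_locus S.

Definition zariski_open (U : set Pn) : Prop := algebraic (~` U).

Definition projective_variety (X : set Pn) : Prop :=
  [/\ algebraic X, X !=set0 &
      forall A B, algebraic A -> algebraic B ->
        X `<=` A `|` B -> X `<=` A \/ X `<=` B].

(* Regular functions on an open subset W of a variety: locally a quotient of
   two homogeneous polynomials of the same degree. *)
Definition regular_on (W : set Pn) (g : Pn -> C) : Prop :=
  forall p, W p -> exists U d (P Q : poly),
    [/\ zariski_open U, U p, homogeneous d P, homogeneous d Q &
        forall q, (U `&` W) q ->
          peval Q (homog q) != 0 /\
          g q = peval P (homog q) / peval Q (homog q)].

(* Cartier data {(U_i, g_i)} on a projective variety X. As X is integral, g_i is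
   a non-zero-divisor iff it does not vanish identically on X n U_i; a unit is a
   nowhere vanishing regular function. *)
Record effective_cartier_divisor (X : set Pn) := EffectiveCartierDivisor {
  cartier_index : Type;
  cartier_dom : cartier_index -> set Pn;
  cartier_eqn : cartier_index -> Pn -> C;
  cartier_open : forall i, zariski_open (cartier_dom i);
  cartier_cover : X `<=` \bigcup_i cartier_dom i;
  cartier_regular : forall i, regular_on (X `&` cartier_dom i) (cartier_eqn i);
  cartier_nonzero : forall i,
    exists2 p, (X `&` cartier_dom i) p & cartier_eqn i p != 0;
  cartier_compat : forall i j, exists u : Pn -> C,
    regular_on (X `&` (cartier_dom i `&` cartier_dom j)) u /\
    forall p, (X `&` (cartier_dom i `&` cartier_dom j)) p ->
      u p != 0 /\ cartier_eqn i p = u p * cartier_eqn j p }.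

Arguments cartier_dom {X} _ _ _.
Arguments cartier_eqn {X} _ _ _.

Definition cartier_support (X : set Pn) (D : effective_cartier_divisor X) :
    set Pn :=
  [set p | X p /\ exists2 i, cartier_dom D i p & cartier_eqn D i p = 0].

(* Holomorphy on an open subset of C, through local holomorphic lifts to
   C^(N+1) \ 0. *)
Definition holomorphic_map (Om : set C) (f : C -> Pn) : Prop :=
  forall z, Om z -> exists F : C -> V,
    \forall w \near z, derivable F w 1 /\ coords (F w) (f w).

Definition unit_disc : set C := [set z | cmod z < 1].

(* Distance of the Poincare metric 4 |dz|^2 / (1 - |z|^2)^2 of the disc. *)
Definition poincare (a b : C) : R :=
  let d := cmod ((a - b) / (1 - b^* * a)) in ln ((1 + d) / (1 - d)).

(* [kobayashi_chain Y p q c]: p and q are joined by a finite chain of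
   holomorphic discs in Y of total Poincare length c. *)
Inductive kobayashi_chain (Y : set Pn) : Pn -> Pn -> R -> Prop :=
| kobayashi_nil p : Y p -> kobayashi_chain Y p p 0
| kobayashi_cons (f : C -> Pn) (a b : C) q c :
    holomorphic_map unit_disc f ->
    (forall z, unit_disc z -> Y (f z)) ->
    unit_disc a -> unit_disc b ->
    kobayashi_chain Y (f b) q c ->
    kobayashi_chain Y (f a) q (poincare a b + c).

Definition kobayashi_dist (Y : set Pn) (p q : Pn) : \bar R :=
  ereal_inf [set c%:E | c in kobayashi_chain Y p q].

Definition kobayashi_set_dist (Y A B : set Pn) : \bar R :=
  ereal_inf [set kobayashi_dist Y p.1 p.2 | p in A `*` B].

Definition kobayashi_hyperbolic (Y : set Pn) : Prop :=
  forall p q, Y p -> Y q -> p != q -> (0 < kobayashi_dist Y p q)%E.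

(* The neighbourhoods U_p, U_q may be taken in P^N, since they are intersected
   with X \ D. *)
Definition hyperbolically_imbedded (X D : set Pn) : Prop :=
  kobayashi_hyperbolic (X `\` D) /\
  forall p q, (X `&` closure (X `\` D)) p -> (X `&` closure (X `\` D)) q ->
    p != q ->
    exists Up Uq, [/\ nbhs p Up, nbhs q Uq &
      (0 < kobayashi_set_dist (X `\` D) (Up `&` (X `\` D))
                                        (Uq `&` (X `\` D)))%E].

(* Real C^k and C^oo functions on an open subset of a real normed space, through
   iterated directional derivatives. *)
Fixpoint Ck (W : normedModType R) (k : nat) (U : set W) (g : W -> R) : Prop :=
  match k with
  | 0%N => forall x, U x -> {for x, continuous g}
  | k'.+1 => forall v : W,
      (forall x, U x -> derivable g x v) /\ Ck k' U (fun x => 'D_v g x)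
  end.

Definition smooth_on (W : normedModType R) (U : set W) (g : W -> R) : Prop :=
  forall k, Ck k U g.

Definition of_real_coords (p : 'rV[R]_N.+1 * 'rV[R]_N.+1) : V :=
  \row_j (p.1 0 j +i* p.2 0 j).

Definition csmooth_on (U : set V) (g : V -> C) : Prop :=
  smooth_on (of_real_coords @^-1` U)
    (fun p => complex.Re (g (of_real_coords p))) /\
  smooth_on (of_real_coords @^-1` U)
    (fun p => complex.Im (g (of_real_coords p))).

Definition hform (G : 'M[C]_N.+1) (a b : V) : C :=
  (a *m G *m (map_mx Num.conj b)^T) 0 0.

(* Smooth positive (1,1)-forms on an open subset U of P^N. The form is encoded
   by its pull-back (i/2) sum_jk G_jk dv_j /\ d(conj v_k) to the cone over U in
   C^(N+1) \ 0. The pull-backs of real (1,1)-forms are exactly the Hermitian G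
   that kill the direction v of the fibre of C^(N+1) \ 0 -> P^N and are invariant
   under C^*; positivity is required on the quotient C^(N+1) / C v, which is the
   tangent space of P^N at [v]. *)
Definition positive_form_on (U : set Pn) (G : V -> 'M[C]_N.+1) : Prop :=
  [/\ forall j k, csmooth_on (cone U) (fun v => G v j k),
      forall v, cone U v -> forall j k, G v k j = (G v j k)^*,
      forall v, cone U v -> v *m G v = 0,
      forall v (c : C), cone U v -> c != 0 -> G (c *: v) = `|c| ^- 2 *: G v &
      forall v a, cone U v -> ~~ (a <= v)%MS -> 0 < hform (G v) a a].

(* Zariski tangent space at v of the affine cone over X; modulo C v it is the
   Zariski tangent space of X at [v]. *)
Definition ztangent (X : set Pn) (v : V) : set V :=
  [set a | forall d (P : poly), homogeneous d P ->
     (forall q, X q -> peval P (homog q) = 0) ->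
     \sum_i a 0 i * peval (mpoly.mderiv i P) v = 0].

(* Smooth positive (1,1)-forms on a possibly singular X: Hermitian forms on the
   Zariski tangent spaces which are locally restrictions of smooth positive
   (1,1)-forms of the ambient space. [eta v a b] is only meaningful for v in the
   cone over X and a, b tangent to that cone at v. *)
Definition positive_form (X : set Pn) (eta : V -> V -> V -> C) : Prop :=
  forall p, X p -> exists (U : set Pn) (G : V -> 'M[C]_N.+1),
    [/\ open U, U p, positive_form_on U G &
        forall v a b, cone (X `&` U) v -> ztangent X v a -> ztangent X v b ->
          eta v a b = hform (G v) a b].

(* The lift of f given near z by an affine chart of P^N at f z. *)
Definition chart_lift (f : C -> Pn) (z : C) : C -> V :=
  let i := odflt ord0 [pick i | homog (f z) 0 i != 0] in
  fun w => (homog (f w) 0 i)^-1 *: homog (f w).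

(* f^* eta = pullback_density f eta (x + iy) dx /\ dy. *)
Definition pullback_density (f : C -> Pn) (eta : V -> V -> V -> C) (z : C) : R :=
  let F := chart_lift f z in
  complex.Re (eta (F z) (derive1 F z) (derive1 F z)).

Definition plane_point (p : R * R) : C := p.1 +i* p.2.

Definition annulus (s t : R) : set (R * R) :=
  [set p | s < cmod (plane_point p) < t].

Definition annulus_integral (f : C -> Pn) (eta : V -> V -> V -> C) (s t : R) :
    \bar R :=
  (\int[lebesgue_measure \x lebesgue_measure]_(p in annulus s t)
     (pullback_density f eta (plane_point p))%:E)%E.

(* T_{f,eta}(r, r1) *)
Definition characteristic (f : C -> Pn) (eta : V -> V -> V -> C) (r r1 : R) :
    \bar R :=
  (\int[lebesgue_measure]_(t in `[r1, r])
     (annulus_integral f eta r1 t * (t^-1)%:E))%E.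

Definition exterior (r0 : R) : set C := [set z | r0 < cmod z].

(* The exceptional set E, of finite measure, also absorbs any bounded range of r,
   so no separate "r large" is needed in O(log r). *)
Definition quantitative_big_picard_property
    (X : set Pn) (r0 : R) (f : C -> Pn) : Prop :=
  exists2 eta : V -> V -> V -> C, positive_form X eta &
    forall r1, r0 < r1 -> exists (A : R) (E : set R),
      [/\ measurable E, (lebesgue_measure E < +oo)%E &
          forall r, r1 <= r -> ~ E r ->
            (characteristic f eta r r1 <= (A * ln r)%:E)%E].

Definition quantitatively_big_picard (X D : set Pn) : Prop :=
  forall (r0 : R) (f : C -> Pn), 1 <= r0 ->
    holomorphic_map (exterior r0) f ->
    (forall z, exterior r0 z -> (X `\` D) (f z)) ->
    quantitative_big_picard_property X r0 f.

End ProjectiveSpace.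

(* Main.v *)
(* Idea.  Take for eta the restriction of the Fubini-Study form.  Because X \ D
   is hyperbolically imbedded in the compact X, there is a constant B bounding
   the Fubini-Study norm of g'(0) for every holomorphic disc g in X \ D: the
   Kobayashi distance keeps g(z), for small |z|, away from the boundary of a
   polydisc of an affine chart around g(0), so by connectedness g maps a disc of
   uniform radius into that polydisc and Cauchy's estimate applies.  Precomposing
   f with w |-> z exp (L w), L = ln (|z| / r0), which maps the unit disc into
   |z| > r0, gives f^* eta <= B dx dy / (|z| ln (|z| / r0))^2.  This density has
   finite total mass on |z| > r1, as a sum over dyadic annuli shows, so that
   T(r, r1) <= K ln r with an empty exceptional set.

   Cauchy's estimate is obtained from Goursat's lemma applied, in the logarithmic
   coordinate s = ln z, to ((h z - h 0) / z): its mean over a circle does not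
   depend on the radius, and tends to h'(0) when the radius tends to 0. *)

(* Compactness of [P^N] is used twice. For fixed [p] and a function [f] of degree 0 with [f p != 0],
   every zero [q] of [f] differs from [p], so a disc starting near [p] needs a definite Poincare
   radius to come near [q]; covering [P^N] by neighbourhoods of such [q] gives one radius on which
   all zeros of [f] are avoided. A second covering, over [p], merges the local derivative bounds
   into one. In both, the radius or the bound is the index of a filter at infinity, so that no
   finite subcover is handled by hand.

   The logarithmic coordinate turns circles into vertical segments of length 2 pi: Goursat's lemma
   on rectangles is then enough, and periodicity cancels the horizontal sides. Line integrals appear
   as differences of primitives, estimated by the mean value theorem.

   [homog] is an arbitrary choice of representatives, so continuity and holomorphy are always
   expressed through functions invariant under scaling or through local lifts. *)
Require Import Defs.
From HB Require Import structures.
From mathcomp Require Import all_boot all_order all_algebra.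
From mathcomp Require Import all_classical all_reals all_analysis.
From mathcomp Require Import measurable_realfun.
From mathcomp.real_closed Require Import complex.
From mathcomp Require mpoly.
From mathcomp Require Import ring lra.
Import (canonicals, coercions) mpoly.

Set Implicit Arguments.
Unset Strict Implicit.
Unset Printing Implicit Defensive.

Import Order.TTheory GRing.Theory Num.Theory.
Import numFieldNormedType.Exports.

Local Open Scope classical_set_scope.
Local Open Scope complex_scope.
Local Open Scope ring_scope.

(** * Goursat's lemma for real 1-forms *)

Lemma continuous_primitive (R : realType) (f : R -> R) (a b : R) :
  continuous f ->
  exists F : R -> R, forall x, a <= x <= b -> is_derive x (1 : R) F (f x).
Proof.
move=> cf.
(* Starting the integral at [a - 1] makes all of [[a, b]] interior, so the derivative is two-sided
   even at the endpoints. *)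
exists (fun x => \int[lebesgue_measure]_(t in [set` `[a - 1, x]]) (f t))%R.
move=> x /andP[ax xb].
have xu : x < b + 1 by lra.
have ai : (@lebesgue_measure R).-integrable `[a - 1, b + 1] (EFin \o f).
  apply: continuous_compact_integrable; first exact: segment_compact.
  exact: continuous_subspaceT.
have ax' : a - 1 < x by lra.
have [dF F'] := @continuous_FTC1_closed R f (a - 1) x (b + 1) xu ai ax' (cf x).
by apply: DeriveDef; [exact: dF | rewrite -derive1E F'].
Qed.

(** Plays the role of integrating the inequality over [[a, b]]: the mean value theorem is applied to
    [F] minus the explicit primitive of the affine model. *)
Lemma primitive_affine_approx (R : realType) (F f : R -> R) (a b x0 k al e : R) :
  a <= b ->
  (forall x, a <= x <= b -> is_derive x (1 : R) F (f x)) ->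
  (forall x, a <= x <= b -> `|f x - (k + al * (x - x0))| <= e) ->
  `|F b - F a - (k * (b - a) + al * ((b - x0) ^+ 2 - (a - x0) ^+ 2) / 2)|
    <= e * (b - a).
Proof.
move=> ab dF fe.
pose G := fun x => F x - (k * x + al * (x - x0) ^+ 2 / 2).
have dG x : a <= x <= b ->
    is_derive x (1 : R) G (f x - (k + al * (x - x0))).
  move=> abx; have ? := dF x abx.
  have D : is_derive x (1 : R) G (f x - (k *: 1 +
    2^-1 *: (al *: ((2 * (x - x0) ^+ 1) *: (1 - 0 : R))))).
    rewrite /G; apply: is_deriveB; apply: is_deriveD.
    have -> : (fun x : R => al * (x - x0) ^+ 2 / 2) =
      2^-1 \*: (al \*: ((fun x : R => x - x0) ^+ 2)).
      by apply/funext => y /=; rewrite /GRing.scale /= mulrC.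
    apply: is_deriveZ; apply: is_deriveZ; exact: is_deriveX.
  apply: (is_derive_eq D).
  by rewrite /GRing.scale /= expr1 subr0 !mulr1; field.
have [c /andP[ac cb] E] : exists2 c, a <= c <= b &
   G b - G a = (f c - (k + al * (c - x0))) * (b - a).
  have [| |c cab ->] := @MVT_segment R G (fun c => f c - (k + al * (c - x0))) a b ab.
  - move=> x; rewrite in_itv /= => /andP[ax xb]; apply: dG; rewrite (ltW ax) (ltW xb) //.
  - apply: derivable_within_continuous => x; rewrite in_itv /= => abx.
    by have [] := dG x abx.
  by exists c.
have -> : F b - F a - (k * (b - a) + al * ((b - x0) ^+ 2 - (a - x0) ^+ 2) / 2)
   = G b - G a by rewrite /G; field.
rewrite E normrM (ger0_norm (_ : 0 <= b - a)) ?subr_ge0 //.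
by apply: ler_wpM2r; rewrite ?subr_ge0 //; apply: fe; rewrite ac cb.
Qed.

Lemma nested_intervals (R : realType) (u v : nat -> R) :
  (forall n, u n <= u n.+1) -> (forall n, v n.+1 <= v n) ->
  (forall n, u n <= v n) -> exists x, forall n, u n <= x <= v n.
Proof.
move=> ui vd uv.
have um : {homo u : m n / (m <= n)%N >-> m <= n} by move/nondecreasing_seqP : ui.
have vm : {homo v : m n / (m <= n)%N >-> n <= m}.
  by move/nonincreasing_seqP : vd.
have ub n : ubound (range u) (v n).
  move=> _ [m _ <-]; apply: (le_trans (um _ (maxn m n) (leq_maxl _ _))).
  exact: le_trans (uv _) (vm _ _ (leq_maxr _ _)).
exists (sup (range u)) => n; apply/andP; split.
  by apply: ub_le_sup; [exists (v 0%N); exact: ub | exists n].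
by apply: ge_sup; [exists (u 0%N), 0%N | exact: ub].
Qed.

(** Bisection in abstract form: a rectangle of stage [n] has sides [w n] and [h n] and is given by
    its lower left corner. *)
Lemma nested_rectangles (R : realType) (w h : nat -> R)
    (bad : nat -> R * R -> Prop) p :
  (forall n, 0 <= w n) -> (forall n, 0 <= h n) ->
  bad 0%N p ->
  (forall n p, bad n p -> exists q,
     [/\ bad n.+1 q, p.1 <= q.1, q.1 + w n.+1 <= p.1 + w n,
         p.2 <= q.2 & q.2 + h n.+1 <= p.2 + h n]) ->
  exists x y, forall n, exists q,
    [/\ bad n q, q.1 <= x <= q.1 + w n & q.2 <= y <= q.2 + h n].
Proof.
move=> w0 h0 b0 step.
have [nxt nxtP] : exists nxt : nat -> R * R -> R * R, forall n p, bad n p ->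
     [/\ bad n.+1 (nxt n p), p.1 <= (nxt n p).1, (nxt n p).1 + w n.+1 <= p.1 + w n,
         p.2 <= (nxt n p).2 & (nxt n p).2 + h n.+1 <= p.2 + h n].
  (* [choice] wants a total relation, hence the conclusion conditional on [bad], with an arbitrary
     value at the other corners. *)
  have /choice[g gP] : forall np : nat * (R * R), exists q, bad np.1 np.2 ->
     [/\ bad np.1.+1 q, np.2.1 <= q.1, q.1 + w np.1.+1 <= np.2.1 + w np.1,
         np.2.2 <= q.2 & q.2 + h np.1.+1 <= np.2.2 + h np.1].
    move=> [n q]; have [/step[q' ?]|nb] := pselect (bad n q); first by exists q'.
    by exists q => /nb.
  by exists (fun n p => g (n, p)) => n q; exact: (gP (n, q)).
pose s := fix s n := if n is m.+1 then nxt m (s m) else p.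
have bs n : bad n (s n) by elim: n => //= n /nxtP[].
have [x xP] : exists x, forall n, (s n).1 <= x <= (s n).1 + w n.
  apply: nested_intervals => n; try by have [] := nxtP _ _ (bs n).
  by rewrite lerDl.
have [y yP] : exists x, forall n, (s n).2 <= x <= (s n).2 + h n.
  apply: nested_intervals => n; try by have [] := nxtP _ _ (bs n).
  by rewrite lerDl.
by exists x, y => n; exists (s n).
Qed.

(** First-order expansion with partial derivatives [al] and [be], tested only at points of the
    rectangle and hence one-sided on its boundary. *)
Definition affine_at (R : realType) (a b c d : R) (P : R -> R -> R)
    (x0 y0 al be : R) :=
  forall e, 0 < e -> exists2 de, 0 < de &
    forall x y, a <= x <= b -> c <= y <= d -> `|x - x0| < de -> `|y - y0| < de ->
    `|P x y - (P x0 y0 + al * (x - x0) + be * (y - y0))|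
      <= e * (`|x - x0| + `|y - y0|).

Section Goursat.
Variables (R : realType) (FP P GQ Q : R -> R -> R) (a b c d : R).
Hypotheses (ab : a < b) (cd : c < d).
Hypothesis dFP : forall x y, a <= x <= b -> c <= y <= d ->
  is_derive x (1 : R) (FP^~ y) (P x y).
Hypothesis dGQ : forall x y, a <= x <= b -> c <= y <= d ->
  is_derive y (1 : R) (GQ x) (Q x y).
(** The shared [be] says that the y-derivative of [P] equals the x-derivative of [Q]: the form
    [P dx + Q dy] is closed, pointwise and without continuity of the derivatives. *)
Hypothesis closed_form : forall x0 y0, a <= x0 <= b -> c <= y0 <= d ->
  exists al be ga, affine_at a b c d P x0 y0 al be /\
                   affine_at a b c d Q x0 y0 be ga.

(** Integral of [P dx + Q dy] counterclockwise along the boundary of the rectangle, each side being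
    a difference of values of [FP] or [GQ]. *)
Definition circulation (a b c d : R) :=
  (FP b c - FP a c) + (GQ b d - GQ b c) - (FP b d - FP a d) - (GQ a d - GQ a c).

(** The affine model of a closed form has circulation zero. What is left is at most [e / 2 * s] at
    each point of a boundary of total length [2 * s]. *)
Lemma circulation_small x0 y0 e : a <= x0 <= b -> c <= y0 <= d -> 0 < e ->
  exists2 de, 0 < de & forall a' b' c' d', a <= a' -> a' <= x0 <= b' -> b' <= b ->
    c <= c' -> c' <= y0 <= d' -> d' <= d -> b' - a' + (d' - c') < de ->
    `|circulation a' b' c' d'| <= e * (b' - a' + (d' - c')) ^+ 2.
Proof.
move=> abx cdy e0; have [al [be [ga [AP AQ]]]] := closed_form abx cdy.
have e20 : 0 < e / 2 by lra.
have [d1 d10 H1] := AP _ e20; have [d2 d20 H2] := AQ _ e20.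
exists (Num.min d1 d2); first by rewrite lt_min d10 d20.
move=> a' b' c' d' aa' /andP[a'x xb'] b'b cc' /andP[c'y yd'] d'd.
set s := _ + (_ - _); rewrite lt_min => /andP[s1 s2].
have in_len (u v w z : R) : u <= w <= v -> u <= z <= v -> `|w - z| <= v - u.
  move=> /andP[uw wv] /andP[uz zv]; rewrite ler_norml opprB.
  by rewrite lerB //= lerB.
have hx x : a' <= x <= b' -> `|x - x0| <= b' - a'.
  by move=> xx; apply: in_len xx _; rewrite a'x.
have hy x : c' <= x <= d' -> `|x - y0| <= d' - c'.
  by move=> xx; apply: in_len xx _; rewrite c'y.
have ab' : a' <= b' := le_trans a'x xb'.
have cd' : c' <= d' := le_trans c'y yd'.
have ws : b' - a' <= s by rewrite lerDl subr_ge0.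
have hs : d' - c' <= s by rewrite lerDr subr_ge0.
have inx x : a' <= x <= b' -> a <= x <= b.
  by move=> /andP[ax xb]; rewrite (le_trans aa' ax) (le_trans xb b'b).
have iny y : c' <= y <= d' -> c <= y <= d.
  by move=> /andP[cy yd]; rewrite (le_trans cc' cy) (le_trans yd d'd).
have K x y : a' <= x <= b' -> c' <= y <= d' ->
   `|P x y - (P x0 y0 + al * (x - x0) + be * (y - y0))| <= e / 2 * s /\
   `|Q x y - (Q x0 y0 + be * (x - x0) + ga * (y - y0))| <= e / 2 * s.
  move=> xx yy; have := hx _ xx; have := hy _ yy => Y X.
  have sle : e / 2 * (`|x - x0| + `|y - y0|) <= e / 2 * s by rewrite ler_pM2l // lerD.
  have Xs := le_trans X ws; have Ys := le_trans Y hs.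
  split; apply: le_trans sle.
    apply: H1; [exact: inx | exact: iny | exact: le_lt_trans s1 | exact: le_lt_trans s1].
  apply: H2; [exact: inx | exact: iny | exact: le_lt_trans s2 | exact: le_lt_trans s2].
have hor y : c' <= y <= d' -> `|FP b' y - FP a' y - ((P x0 y0 + be * (y - y0)) * (b' - a') +
    al * ((b' - x0) ^+ 2 - (a' - x0) ^+ 2) / 2)| <= e / 2 * s * (b' - a').
  move=> yy; apply: (@primitive_affine_approx _ (FP^~ y) (P^~ y)) => //.
    by move=> x xx; apply: dFP; [exact: inx | exact: iny].
  by move=> x xx; have [+ _] := K x y xx yy; rewrite addrAC.
have ver x : a' <= x <= b' -> `|GQ x d' - GQ x c' - ((Q x0 y0 + be * (x - x0)) * (d' - c') +
    ga * ((d' - y0) ^+ 2 - (c' - y0) ^+ 2) / 2)| <= e / 2 * s * (d' - c').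
  move=> xx; apply: (@primitive_affine_approx _ (GQ x) (Q x)) => //.
    by move=> y yy; apply: dGQ; [exact: inx | exact: iny].
  by move=> y yy; have [_ +] := K x y xx yy.
have /hor : c' <= c' <= d' by rewrite lexx.
have /hor : c' <= d' <= d' by rewrite lexx andbT.
have /ver : a' <= a' <= b' by rewrite lexx.
have /ver : a' <= b' <= b' by rewrite lexx andbT.
set t1 := _ - (_ + _); set t2 := _ - (_ + _); set t3 := _ - (_ + _); set t4 := _ - (_ + _).
move=> h1 h2 h3 h4.
(* The models of opposite sides differ by [be] times the area, with opposite signs for the
   horizontal and the vertical pair, so they cancel. *)
have -> : circulation a' b' c' d' = t4 + t1 - t3 - t2.
  by rewrite /t1 /t2 /t3 /t4 /circulation; field.
have -> : e * s ^+ 2 = e / 2 * s * (b' - a') + e / 2 * s * (d' - c') +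
   e / 2 * s * (b' - a') + e / 2 * s * (d' - c') by rewrite /s; field.
apply: (le_trans (ler_normB _ _)); apply: lerD => //.
apply: (le_trans (ler_normB _ _)); apply: lerD => //.
by apply: (le_trans (ler_normD _ _)); apply: lerD.
Qed.

(** Circulation is additive under quartering, so some quarter keeps at least a fourth of its
    modulus. At the limit point this contradicts the quadratic smallness of [circulation_small]. *)
Theorem goursat : circulation a b c d = 0.
Proof.
apply/eqP; case: (eqVneq (circulation a b c d) 0) => // n0; exfalso.
set I : R := `|circulation a b c d|.
have I0 : 0 < I by rewrite normr_gt0.
pose w n : R := (b - a) / 2 ^+ n; pose h n : R := (d - c) / 2 ^+ n.
pose bad n (p : R * R) := [/\ I / 4 ^+ n <= `|circulation p.1 (p.1 + w n) p.2 (p.2 + h n)|,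
  a <= p.1, p.1 + w n <= b, c <= p.2 & p.2 + h n <= d].
have w0 n : 0 < w n by apply: divr_gt0; rewrite ?subr_gt0 ?exprn_gt0.
have h0 n : 0 < h n by apply: divr_gt0; rewrite ?subr_gt0 ?exprn_gt0.
have wS n : w n = w n.+1 + w n.+1.
  by rewrite /w exprS; field; rewrite expf_neq0.
have hS n : h n = h n.+1 + h n.+1.
  by rewrite /h exprS; field; rewrite expf_neq0.
have [||||x [y xyP]] := @nested_rectangles R w h bad (a, c).
- by move=> n; exact: ltW.
- by move=> n; exact: ltW.
- by rewrite /bad /= /w /h !expr0 !divr1 !subrKC; split => //; lra.
- move=> n [x y] [/= IC ax xb cy yd].
  have := w0 n.+1; have := h0 n.+1; have := wS n; have := hS n.
  set hn := h n in IC yd *; set wn := w n in IC xb *.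
  set hm := h n.+1; set wm := w n.+1 => hE wE h00 w00.
  pose C p := circulation p.1 (p.1 + wm) p.2 (p.2 + hm).
  have split4 : circulation x (x + wn) y (y + hn) =
     C (x, y) + C (x + wm, y) + C (x, y + hm) + C (x + wm, y + hm).
    by rewrite /C /circulation /= wE hE !addrA; ring.
  have [q [Cq q1 q2]] : exists q, [/\ I / 4 ^+ n.+1 <= `|C q|, q.1 = x \/ q.1 = x + wm &
       q.2 = y \/ q.2 = y + hm].
    apply: contrapT => /forallNP nq.
    have lt4 q : (q.1 = x \/ q.1 = x + wm) -> (q.2 = y \/ q.2 = y + hm) ->
      `|C q| < I / 4 ^+ n.+1.
      by move=> ? ?; rewrite ltNge; apply/negP => ?; apply: (nq q).
    have : I / 4 ^+ n < I / 4 ^+ n; last by rewrite ltxx.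
    apply: (le_lt_trans IC); rewrite split4.
    have -> : I / 4 ^+ n = I / 4 ^+ n.+1 + I / 4 ^+ n.+1 + I / 4 ^+ n.+1 + I / 4 ^+ n.+1.
      by rewrite exprS; field; rewrite expf_neq0.
    do 3 (apply: (le_lt_trans (ler_normD _ _)); apply: ltrD; last by apply: lt4 => /=; auto).
    by apply: lt4 => /=; auto.
  exists q; case: q Cq q1 q2 => u v /= Cq q1 q2; rewrite /bad /= -/hm -/wm.
  have [xu ux] : x <= u /\ u <= x + wm by case: q1 => ->; rewrite lexx lerDl (ltW w00).
  have [yv vy] : y <= v /\ v <= y + hm by case: q2 => ->; rewrite lexx lerDl (ltW h00).
  have uw : u + wm <= x + wn by rewrite wE addrA lerD2r.
  have vh : v + hm <= y + hn by rewrite hE addrA lerD2r.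
  split=> //; split=> //.
  - exact: le_trans ax xu.
  - exact: le_trans uw xb.
  - exact: le_trans cy yv.
  - exact: le_trans vh yd.
have [[u v] [[/= _ ? ? ? ?] xx yy]] := xyP 0%N.
have abx : a <= x <= b.
  by have /andP[ux xw] := xx; rewrite (le_trans _ ux) // (le_trans xw).
have cdy : c <= y <= d.
  by have /andP[vy yh] := yy; rewrite (le_trans _ vy) // (le_trans yh).
set s := b - a + (d - c).
have s0 : 0 < s by rewrite addr_gt0 ?subr_gt0.
(* At stage [n] the width plus the height is [s / 2 ^+ n]; this tolerance gives the upper bound
   [I / 2 / 4 ^+ n], half of the lower bound in [bad]. *)
have e0 : 0 < I / (2 * s ^+ 2) by rewrite divr_gt0 // mulr_gt0 // exprn_gt0.
have [de de0 H] := circulation_small abx cdy e0.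
have [n sn] : exists n, s / 2 ^+ n < de.
  exists (Num.truncn (s / de)).+1; rewrite ltr_pdivrMr ?exprn_gt0 // mulrC -ltr_pdivrMr //.
  apply: (lt_trans (truncnS_gt _)).
  by rewrite -natrX ltr_nat; exact: ltn_expl.
have [[x1 y1] [[/= B1 B2 B3 B4 B5] B6 B7]] := xyP n.
have := H x1 (x1 + w n) y1 (y1 + h n) B2 B6 B3 B4 B7 B5.
have -> : x1 + w n - x1 + (y1 + h n - y1) = s / 2 ^+ n.
  by rewrite /w /h /s; field; rewrite expf_neq0.
move=> /(_ sn) /(le_trans B1).
have -> : I / (2 * s ^+ 2) * (s / 2 ^+ n) ^+ 2 = I / 2 / 4 ^+ n.
  have -> : 4 ^+ n = (2 ^+ n) ^+ 2 :> R by rewrite exprAC; congr (_ ^+ n); ring.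
  by field; rewrite expf_neq0 // lt0r_neq0.
rewrite ler_pM2r ?invr_gt0 ?exprn_gt0 //; lra.
Qed.

End Goursat.

(** * Modulus, complex derivatives and the complex exponential *)

(** The division-free form includes [w = x] and reduces differentiation to inequalities. *)
Lemma is_derive1P (K : numFieldType) (f : K -> K) (x D : K) :
  is_derive x (1 : K) f D <->
  forall e, 0 < e -> \forall w \near x, `|f w - f x - D * (w - x)| <= e * `|w - x|.
Proof.
split=> [[df Df] e e0 | H].
  have := df; rewrite /derivable -/(derive f x 1) => /cvg_ex[l cl].
  have lD : l = D by rewrite -Df; apply: esym; exact: (cvg_lim (@norm_hausdorff _ _) cl).
  rewrite lD in cl; move/cvgrPdist_le : cl => /(_ _ e0).
  rewrite near_withinE => H.
  have : \forall w \near x, w - x != 0 ->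
     `|D - (w - x)^-1 *: ((f \o shift x) ((w - x) *: (1 : K)) - f x)| <= e.
    have : (fun w => w - x) @ x --> (0 : K).
      rewrite -(subrr x); apply: (@cvgB K K _ (nbhs x) _ id (cst x)).
        exact: cvg_id.
      exact: cvg_cst.
    by move=> /(_ _ H).
  apply: filterS => w; have [->|nwx Hw] := eqVneq w x.
    by rewrite !subrr mulr0 subr0 normr0 mulr0.
  have wx : w - x != 0 by rewrite subr_eq0.
  have := Hw wx; rewrite /= /GRing.scale /= mulr1 subrK => K1.
  have -> : f w - f x - D * (w - x) =
    - ((D - (w - x)^-1 * (f w - f x)) * (w - x)) by field.
  by rewrite normrN normrM; apply: ler_wpM2r.
have cl : (fun h => h^-1 *: ((f \o shift x) (h *: (1 : K)) - f x)) @ 0^' --> D.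
  apply/cvgrPdist_le => e e0; rewrite near_withinE.
  have : (fun h : K => h + x) @ (0 : K) --> x.
    rewrite -[X in _ --> X](add0r x); apply: (@cvgD K K _ (nbhs (0 : K)) _ id (cst x)).
      exact: cvg_id.
    exact: cvg_cst.
  move=> /(_ _ (H e e0)); apply: (@filterS _ (nbhs (0 : K)) _) => h /= Hh h0.
  rewrite /GRing.scale /= mulr1; move: Hh; rewrite addrK => Hh.
  have -> : D - h^-1 * (f (h + x) - f x) = - ((f (h + x) - f x - D * h) / h) by field.
  by rewrite normrN normrM normfV ler_pdivrMr // normr_gt0.
by apply: DeriveDef; [apply/cvg_ex; exists D | apply: cvg_lim].
Qed.

Lemma is_derive1_chain (K : numFieldType) (V : normedModType K) (f : K -> K)
    (g : K -> V) (z df : K) (dg : V) :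
  is_derive z (1 : K) f df -> is_derive (f z) (1 : K) g dg ->
  is_derive z (1 : K) (fun x => g (f x)) (df *: dg).
Proof.
move=> [/derivable1_diffP Df fE] [/derivable1_diffP Dg gE].
have Dh : differentiable (g \o f) z := differentiable_comp Df Dg.
apply: DeriveDef; first exact/derivable1_diffP.
have -> : 'D_1 (fun x => g (f x)) z = 'd (g \o f) z 1 := deriveE _ Dh.
rewrite diff_comp //=.
by rewrite (diff1E Df) (diff1E Dg) /= !derive1E fE gE scale1r.
Qed.

Section Modulus.
Variable R : realType.
Local Notation C := (Cplx R).
Implicit Types z w : C.

Lemma normC_cmod z : `|z| = (cmod z)%:C :> C.
Proof. by rewrite /cmod; case: z => x y. Qed.

Lemma cmod_ge0 z : 0 <= cmod z.
Proof. by rewrite -(@ler0c R) -normC_cmod. Qed.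

Lemma cmodM z w : cmod (z * w) = cmod z * cmod w.
Proof. by apply: (@complexI R); rewrite rmorphM /= -!normC_cmod normrM. Qed.

Lemma cmodV z : cmod z^-1 = (cmod z)^-1.
Proof. by apply: (@complexI R); rewrite fmorphV /= -!normC_cmod normfV. Qed.

Lemma cmodN z : cmod (- z) = cmod z.
Proof. by apply: (@complexI R); rewrite -!normC_cmod normrN. Qed.

Lemma cmod0 : cmod (0 : C) = 0.
Proof. by apply: (@complexI R); rewrite -!normC_cmod normr0. Qed.

Lemma cmod_eq0 z : (cmod z == 0) = (z == 0).
Proof. by rewrite -(normr_eq0 z) normC_cmod (inj_eq (@complexI R)). Qed.

Lemma cmod_gt0 z : (0 < cmod z) = (z != 0).
Proof. by rewrite lt0r cmod_ge0 andbT cmod_eq0. Qed.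

Lemma cmodD z w : cmod (z + w) <= cmod z + cmod w.
Proof. by rewrite -lecR rmorphD /= -!normC_cmod ler_normD. Qed.

Lemma cmodB z w : cmod (z - w) <= cmod z + cmod w.
Proof. by rewrite -(cmodN w) cmodD. Qed.

Lemma cmod_distC z w : cmod (z - w) = cmod (w - z).
Proof. by rewrite -cmodN opprB. Qed.

Lemma cmod_real (x : R) : cmod (x%:C : C) = `|x|.
Proof. by rewrite /cmod normc_def /= expr0n addr0 sqrtr_sqr. Qed.

Lemma cmodE z : cmod z ^+ 2 = complex.Re z ^+ 2 + complex.Im z ^+ 2.
Proof.
by rewrite /cmod normc_def /= sqr_sqrtr // addr_ge0 ?sqr_ge0.
Qed.

Lemma Re_le_cmod z : `|complex.Re z| <= cmod z.
Proof.
rewrite -(@ler_pXn2r _ 2) ?nnegrE ?cmod_ge0 // cmodE real_normK ?num_real //.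
by rewrite lerDl sqr_ge0.
Qed.

Lemma Im_le_cmod z : `|complex.Im z| <= cmod z.
Proof.
rewrite -(@ler_pXn2r _ 2) ?nnegrE ?cmod_ge0 // cmodE real_normK ?num_real //.
by rewrite lerDr sqr_ge0.
Qed.

Lemma cmod_le_ReIm z : cmod z <= `|complex.Re z| + `|complex.Im z|.
Proof.
rewrite -(@ler_pXn2r _ 2) ?nnegrE ?cmod_ge0 ?addr_ge0 // cmodE sqrrD.
rewrite !real_normK ?num_real // addrAC lerDl.
by rewrite mulrn_wge0 // mulr_ge0.
Qed.

Lemma near_cmodP z (P : set C) :
  (\forall w \near z, P w) <-> exists2 e : R, 0 < e & forall w, cmod (w - z) < e -> P w.
Proof.
split=> [/nbhs_normP[e /= e0 He] | [e e0 He]].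
  (* In the partial order of [R[i]], being positive forces the imaginary part to vanish. *)
  have er : e = (complex.Re e)%:C.
    by case: (e) e0 => a b; rewrite ltcE /= => /andP[/eqP -> _].
  exists (complex.Re e); first by rewrite -ltcR -er.
  move=> w; rewrite -ltcR -normC_cmod -er => we; apply: He.
  by rewrite /ball_ /= distrC.
apply/nbhs_normP; exists (e%:C) => /=; first by rewrite ltcR.
by move=> w; rewrite /ball_ /= distrC normC_cmod ltcR; exact: He.
Qed.

Lemma is_deriveCP (h : C -> C) (z D : C) : is_derive z (1 : C) h D <->
  forall e : R, 0 < e -> exists2 d : R, 0 < d &
    forall w, cmod (w - z) < d -> cmod (h w - h z - D * (w - z)) <= e * cmod (w - z).
Proof.
split=> [/is_derive1P H e e0 | H].
  have /H /near_cmodP[d d0 Hd] : (0 : C) < e%:C by rewrite ltcR.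
  by exists d => // w /Hd; rewrite !normC_cmod -rmorphM /= lecR.
apply/is_derive1P => e e0; apply/near_cmodP.
have er : e = (complex.Re e)%:C.
  by case: (e) e0 => a b; rewrite ltcE /= => /andP[/eqP -> _].
have /H[d d0 Hd] : 0 < complex.Re e by rewrite -ltcR -er.
by exists d => // w /Hd; rewrite !normC_cmod {2}er -rmorphM /= lecR.
Qed.

End Modulus.

Section ComplexExponential.
Variable R : realType.
Local Notation C := (Cplx R).
Implicit Types z w : C.

Definition cexp z : C :=
  (expR (complex.Re z) * cos (complex.Im z)) +i* (expR (complex.Re z) * sin (complex.Im z)).

Lemma cexpD z w : cexp (z + w) = cexp z * cexp w.
Proof.
case: z w => [a b] [c d]; rewrite /cexp /= expRD cosD sinD.
by apply/eqP; rewrite eq_complex /=; apply/andP; split; apply/eqP; ring.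
Qed.

Lemma cmod_cexp z : cmod (cexp z) = expR (complex.Re z).
Proof.
apply/eqP; rewrite -(@eqrXn2 _ 2) ?cmod_ge0 ?expR_ge0 // cmodE /=.
by rewrite !exprMn -mulrDr cos2Dsin2 mulr1.
Qed.

Lemma cexp_neq0 z : cexp z != 0.
Proof. by rewrite -cmod_gt0 cmod_cexp expR_gt0. Qed.

Lemma cexp0 : cexp 0 = 1.
Proof. by rewrite /cexp /= expR0 cos0 sin0 mulr1 mulr0. Qed.

Lemma real_derive_approx (f : R -> R) (D e : R) : is_derive (0 : R) (1 : R) f D -> 0 < e ->
  exists2 d : R, 0 < d & forall x, `|x| < d -> `|f x - f 0 - D * x| <= e * `|x|.
Proof.
move=> /is_derive1P/(_ e) H /H /nbhs_normP[d /= d0 Hd]; exists d => // x xd.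
by have := Hd x; rewrite /ball_ /= !subr0 sub0r normrN; exact.
Qed.

Lemma cexp_deriv0 (e : R) : 0 < e -> exists2 d : R, 0 < d &
  forall w, cmod w < d -> cmod (cexp w - 1 - w) <= e * cmod w.
Proof.
(* Six error terms of size [k * r] will be added, so [e / 8] suffices; [k <= 1] is used to absorb
   products of errors. *)
move=> e0; have e80 : 0 < Num.min (e / 8) 1.
  by rewrite lt_min ltr01 divr_gt0.
set k := Num.min _ _ in e80.
have ke : k <= e / 8 by rewrite ge_min lexx.
have k1 : k <= 1 by rewrite ge_min lexx orbT.
have De : is_derive (0 : R) (1 : R) expR 1 by have := is_derive_expR (0 : R); rewrite expR0.
have Dc : is_derive (0 : R) (1 : R) cos 0.
  by have := is_derive_cos (0 : R); rewrite sin0 oppr0.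
have Ds : is_derive (0 : R) (1 : R) sin 1 by have := is_derive_sin (0 : R); rewrite cos0.
have [d1 d10 H1] := real_derive_approx De e80.
have [d2 d20 H2] := real_derive_approx Dc e80.
have [d3 d30 H3] := real_derive_approx Ds e80.
(* The radius [k / 2] yields [|expR x - 1| <= k * r + r <= 2 * r <= k]. *)
exists (Num.min (Num.min d1 d2) (Num.min d3 (k / 2))).
  by rewrite !lt_min d10 d20 d30 divr_gt0.
move=> w; rewrite !lt_min => /andP[/andP[w1 w2] /andP[w3 w4]].
have X := Re_le_cmod w; have Y := Im_le_cmod w.
have {H1} := H1 _ (le_lt_trans X w1); have {H2} := H2 _ (le_lt_trans Y w2).
have {H3} := H3 _ (le_lt_trans Y w3).
set x := complex.Re w in X *; set y := complex.Im w in Y *; set r := cmod w in X Y w1 w2 w3 w4 *.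
rewrite expR0 cos0 sin0 subr0 !mul1r mul0r subr0 => S3 S2 S1.
have r0 : 0 <= r := cmod_ge0 w.
have kr (a : R) : `|a| <= r -> k * `|a| <= k * r by move=> ?; rewrite ler_wpM2l // ltW.
have {}S1 : `|expR x - 1 - x| <= k * r := le_trans S1 (kr _ X).
have {}S2 : `|cos y - 1| <= k * r := le_trans S2 (kr _ Y).
have {}S3 : `|sin y - y| <= k * r := le_trans S3 (kr _ Y).
have krr : k * r <= r by rewrite ler_piMl.
have E1 : `|expR x - 1| <= k.
  have -> : expR x - 1 = (expR x - 1 - x) + x by ring.
  by apply: (le_trans (ler_normD _ _)); lra.
have E2 : `|expR x| <= 2.
  have -> : expR x = (expR x - 1) + 1 by ring.
  by apply: (le_trans (ler_normD _ _)); rewrite normr1; lra.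
apply: (le_trans (cmod_le_ReIm _)).
have -> : complex.Re (cexp w - 1 - w) = (expR x - 1 - x) + expR x * (cos y - 1).
  by rewrite /x /y; case: (w) => a b /=; ring.
have -> : complex.Im (cexp w - 1 - w) = expR x * (sin y - y) + (expR x - 1) * y.
  by rewrite /x /y; case: (w) => a b /=; ring.
have kr0 : 0 <= k * r by rewrite mulr_ge0 // ltW.
have T1 : `|expR x * (cos y - 1)| <= 2 * (k * r) by rewrite normrM ler_pM.
have T2 : `|expR x * (sin y - y)| <= 2 * (k * r) by rewrite normrM ler_pM.
have T3 : `|(expR x - 1) * y| <= k * r by rewrite normrM ler_pM.
have ker : k * r <= e / 8 * r by rewrite ler_wpM2r.
have := ler_normD (expR x - 1 - x) (expR x * (cos y - 1)).
have := ler_normD (expR x * (sin y - y)) ((expR x - 1) * y).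
move: ker; rewrite mulrAC => ker; lra.
Qed.

Lemma is_derive_cexp z : is_derive z (1 : C) cexp (cexp z).
Proof.
apply/is_deriveCP => e e0.
have M0 : 0 < cmod (cexp z) by rewrite cmod_gt0 cexp_neq0.
have /cexp_deriv0[d d0 Hd] : 0 < e / cmod (cexp z) by rewrite divr_gt0.
exists d => // w /Hd.
have -> : cexp w - cexp z - cexp z * (w - z) = cexp z * (cexp (w - z) - 1 - (w - z)).
  by rewrite -{1}(subrK z w) (cexpD (w - z) z); ring.
rewrite cmodM => H; rewrite -(@ler_pM2l _ (cmod (cexp z))) // in H.
by apply: (le_trans H); rewrite mulrA mulrCA divff ?mulr1 ?lt0r_neq0.
Qed.

End ComplexExponential.

(** * Cauchy's estimate *)

Section MeanValue.
Variable R : realType.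
Local Notation C := (Cplx R).

Lemma derive_lipschitz_at (g : C -> C) (z : C) : derivable g z 1 ->
  exists L d : R, [/\ 0 < L, 0 < d &
    forall w, cmod (w - z) < d -> cmod (g w - g z) <= L * cmod (w - z)].
Proof.
move=> /derivableP/is_deriveCP/(_ _ ltr01)[d d0 H].
exists (cmod ('D_1 g z) + 1), d; split => //; first by rewrite ltr_wpDl ?cmod_ge0.
move=> w /H {}H; rewrite -[g w - g z](subrK ('D_1 g z * (w - z))).
apply: (le_trans (cmodD _ _)).
by rewrite cmodM mulrDl addrC lerD2l.
Qed.

(** On the rectangle [[a, b] x [0, 2 pi]] the horizontal sides cancel by periodicity, so the means
    of [Re g] over the two vertical sides agree. One is within [e1] of [m1], the other within [e2]
    of [m2]. *)
Lemma mean_value_periodic (g : C -> C) (a b m1 m2 e1 e2 : R) : a < b ->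
  (forall s, complex.Re s <= b -> derivable g s 1) ->
  (forall x : R, g (x +i* (pi *+ 2)) = g (x +i* 0)) ->
  (forall y : R, `|complex.Re (g (b +i* y)) - m1| <= e1) ->
  (forall y : R, `|complex.Re (g (a +i* y)) - m2| <= e2) ->
  `|m1 - m2| <= e1 + e2.
Proof.
move=> ab dg per H1 H2.
(* [g] is controlled only for real part at most [b], while primitives are taken of functions
   continuous on all of [R]. Clipping keeps the local Lipschitz estimate because [Num.min] is
   1-Lipschitz. *)
pose gc (x y : R) : C := g (Num.min x b +i* y).
have gcE x y : x <= b -> gc x y = g (x +i* y) by move=> xb; rewrite /gc min_l.
have gL x y : exists L d : R, [/\ 0 < L, 0 < d & forall x' y', `|x' - x| < d ->
    `|y' - y| < d -> cmod (gc x' y' - gc x y) <= L * (`|x' - x| + `|y' - y|)].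
  have [|L [d [L0 d0 H]]] := @derive_lipschitz_at g (Num.min x b +i* y).
    by apply: dg; rewrite /= ge_min lexx orbT.
  exists L, (d / 2); split => //; first by rewrite divr_gt0.
  move=> x' y' x'd y'd; rewrite /gc.
  set w := (Num.min x' b +i* y'); set z := (Num.min x b +i* y).
  have wz : cmod ((w : C) - z) <= `|x' - x| + `|y' - y|.
    apply: (le_trans (cmod_le_ReIm _)) => /=; rewrite lerD2r.
    have := ler_norm (x' - x); have := ler_norm (- (x' - x)); rewrite normrN.
    by rewrite ler_norml; case: (lerP x' b); case: (lerP x b) => *; apply/andP; split; lra.
  apply: (le_trans (H _ _)); first by apply: (le_lt_trans wz); lra.
  by rewrite ler_wpM2l // ltW.
(* The primitive is made a function of the integrand: equal integrands on the two horizontal sides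
   then give literally equal primitives. The interval contains both [[a, b]] and [[0, 2 pi]], so one
   operator serves both directions. *)
have [prim primP] : exists prim : (R -> R) -> R -> R, forall f, continuous f ->
   forall x, Num.min a 0 <= x <= Num.max b (pi *+ 2) -> is_derive x (1 : R) (prim f) (f x).
  have /choice[F FP] : forall f : R -> R, exists F : R -> R, continuous f ->
     forall x, Num.min a 0 <= x <= Num.max b (pi *+ 2) -> is_derive x (1 : R) F (f x).
    move=> f; have [cf|nc] := pselect (continuous f); last by exists f.
    have [F FP] := @continuous_primitive R f (Num.min a 0) (Num.max b (pi *+ 2)) cf.
    by exists F.
  by exists F.
(* [P dx + Q dy] is the real part of [- 'i g ds], clipped to [x <= b]. *)
pose P x y := complex.Im (gc x y); pose Q x y := complex.Re (gc x y).
have cont x y e : 0 < e -> exists2 d : R, 0 < d & forall x' y', `|x' - x| < d ->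
    `|y' - y| < d -> cmod (gc x' y' - gc x y) <= e.
  move=> e0; have [L [d [L0 d0 H]]] := gL x y.
  exists (Num.min d (e / (L * 2))); first by rewrite lt_min d0 divr_gt0 // mulr_gt0.
  move=> x' y'; rewrite !lt_min => /andP[x1 x2] /andP[y1 y2].
  apply: (le_trans (H _ _ x1 y1)); rewrite mulrC -ler_pdivlMr //.
  have -> : e / L = e / (L * 2) + e / (L * 2) by field; exact: lt0r_neq0.
  by rewrite lerD // ltW.
have cP y : continuous (P^~ y).
  move=> x; apply/cvgrPdist_le => e /(cont x y)[d d0 H].
  near=> x'; rewrite distrC.
  have := Im_le_cmod (gc x' y - gc x y); rewrite raddfB /= => /le_trans; apply.
  apply: H; last by rewrite subrr normr0.
  by rewrite distrC; near: x'; exact: cvgr_dist_lt.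
have cQ x : continuous (Q x).
  move=> y; apply/cvgrPdist_le => e /(cont x y)[d d0 H].
  near=> y'; rewrite distrC.
  have := Re_le_cmod (gc x y' - gc x y); rewrite raddfB /= => /le_trans; apply.
  apply: H; first by rewrite subrr normr0.
  by rewrite distrC; near: y'; exact: cvgr_dist_lt.
have pi2 : 0 < pi *+ 2 :> R by rewrite mulrn_wgt0 // pi_gt0.
have inI x : a <= x <= b -> Num.min a 0 <= x <= Num.max b (pi *+ 2).
  by move=> /andP[ax xb]; rewrite ge_min ax le_max xb.
have inJ x : 0 <= x <= pi *+ 2 -> Num.min a 0 <= x <= Num.max b (pi *+ 2).
  by move=> /andP[ax xb]; rewrite ge_min ax le_max xb !orbT.
have G : circulation (fun x y => prim (P^~ y) x) (fun x y => prim (Q x) y)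
    a b 0 (pi *+ 2) = 0.
  apply: (@goursat R _ P _ Q) => //.
  - by move=> x y xx yy; apply: primP; [exact: cP | exact: inI].
  - by move=> x y xx yy; apply: primP; [exact: cQ | exact: inJ].
  move=> x0 y0 /andP[ax0 x0b] yy0.
  have /derivableP/is_deriveCP Hd := dg (x0 +i* y0) x0b.
  set D := derive _ _ _ in Hd.
  have K (e : R) : 0 < e -> exists2 de : R, 0 < de & forall x y, a <= x <= b -> `|x - x0| < de ->
     `|y - y0| < de -> cmod (gc x y - gc x0 y0 - D * ((x - x0) +i* (y - y0))) <=
       e * (`|x - x0| + `|y - y0|).
    move=> e0; have [d d0 H] := Hd e e0.
    exists (d / 2); first by rewrite divr_gt0.
    move=> x y /andP[ax xb] xd yd; rewrite !gcE //.
    have n1 : cmod ((x - x0) +i* (y - y0) : C) <= `|x - x0| + `|y - y0|.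
      exact: cmod_le_ReIm.
    have xyE : (x +i* y : C) - (x0 +i* y0) = (x - x0) +i* (y - y0) by [].
    have := H (x +i* y); rewrite xyE => /(_ (le_lt_trans n1 _)) H'.
    by apply: le_trans (H' _) _; [lra | rewrite ler_wpM2l // ltW].
  (* The Cauchy-Riemann equations: multiplication by [D] has real part [Re D dx - Im D dy] and
     imaginary part [Im D dx + Re D dy]. *)
  exists (complex.Im D), (complex.Re D), (- complex.Im D).
  split => e e0; have [de de0 H] := K e e0; exists de => // x y xx yy xd yd;
    apply: le_trans (H x y xx xd yd).
    apply: le_trans (Im_le_cmod _); rewrite le_eqVlt; apply/orP; left; apply/eqP; congr `|_|.
    by rewrite /P; case: (gc x y) (gc x0 y0) (D) => [? ?] [? ?] [? ?] /=; ring.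
  apply: le_trans (Re_le_cmod _); rewrite le_eqVlt; apply/orP; left; apply/eqP; congr `|_|.
  by rewrite /Q; case: (gc x y) (gc x0 y0) (D) => [? ?] [? ?] [? ?] /=; ring.
have vert x m e : a <= x <= b -> (forall y, `|complex.Re (g (x +i* y)) - m| <= e) ->
   `|prim (Q x) (pi *+ 2) - prim (Q x) 0 - m * (pi *+ 2)| <= e * (pi *+ 2).
  move=> /andP[ax xb] He.
  have := @primitive_affine_approx R (prim (Q x)) (Q x) 0 (pi *+ 2) 0 m 0 e (ltW pi2).
  rewrite !mul0r addr0 subr0; apply.
    by move=> y yy; apply: primP; [exact: cQ | exact: inJ].
  by move=> y _; rewrite mul0r addr0 /Q gcE.
have := vert b m1 e1; rewrite lexx (ltW ab) => /(_ isT H1).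
have := vert a m2 e2; rewrite lexx (ltW ab) => /(_ isT H2).
move: G; rewrite /circulation.
have -> : P^~ (pi *+ 2) = P^~ 0 by apply/funext => x; rewrite /P /gc per.
set A := prim (Q a) _ - _; set B := prim (Q b) _ - _ => G.
have -> : A = B by move: G; lra.
move=> h1 h2; rewrite -(ler_pM2r pi2).
have -> : `|m1 - m2| * (pi *+ 2) = `|(B - m2 * (pi *+ 2)) - (B - m1 * (pi *+ 2))|.
  by rewrite -{1}(gtr0_norm pi2) -normrM; congr `|_|; ring.
by apply: (le_trans (ler_normB _ _)); rewrite mulrDl addrC lerD.
Unshelve. all: by end_near. Qed.

(** The difference quotient at 0 is compared on the circle of radius [d / 2], where it is at most
    [2 * M / (d / 2)], and on a tiny circle, where it is close to [D]. This is the origin of the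
    factor 4. *)
Lemma schwarz_estimate (h : C -> C) (M d : R) : 0 < d ->
  (forall z, cmod z < d -> derivable h z 1) ->
  (forall z, cmod z < d -> cmod (h z) <= M) ->
  cmod ('D_1 h 0) <= 4 * M / d.
Proof.
move=> d0 dh hM; set D : C := 'D_1 h 0.
(* The nonzero case ends by cancelling [cmod D]. *)
have [D0|Dn0] := eqVneq D 0.
  rewrite D0 cmod0 divr_ge0 ?(ltW d0) // mulr_ge0 // (le_trans (cmod_ge0 (h 0))) //.
  by apply: hM; rewrite cmod0.
have cD : 0 < cmod D by rewrite cmod_gt0.
have /is_deriveCP hD : is_derive (0 : C) 1 h D by apply/derivableP/dh; rewrite cmod0.
apply/ler_addgt0Pr => e e0; have [r r0 Hr] := hD e e0.
(* The factor [conjc D] turns the limit of the quotient into the real number [cmod D ^+ 2], so that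
   real parts carry all the information. *)
pose g (s : C) : C := conjc D * ((h (cexp s) - h 0) / cexp s).
set b : R := ln (d / 2).
set a : R := Num.min (ln (r / 2)) (b - 1).
have eb : expR b = d / 2 by rewrite lnK // posrE divr_gt0.
have ab : a < b by rewrite gt_min; apply/orP; right; lra.
have ea : expR a < r.
  apply: (@le_lt_trans _ _ (r / 2)); last by lra.
  have -> : r / 2 = expR (ln (r / 2)) by rewrite lnK // posrE divr_gt0.
  by rewrite ler_expR ge_min lexx.
have dg (s : C) : complex.Re s <= b -> derivable g s 1.
  move=> sb.
  have dhc : derivable (fun s => h (cexp s)) s 1.
    have ds : cmod (cexp s) < d.
      rewrite cmod_cexp; apply: (@le_lt_trans _ _ (expR b)); last by rewrite eb; lra.
      by rewrite ler_expR.
    by have [] := is_derive1_chain (is_derive_cexp s) (derivableP (dh _ ds)).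
  have dc : derivable (@cexp R : C -> C) s 1 by have [] := is_derive_cexp s.
  have -> : g = (conjc D : C) \*: (((fun s => h (cexp s)) - cst (h 0)) * (fun s => (cexp s)^-1)).
    by [].
  apply: derivableZ; apply: derivableM; last by apply: derivableV dc; exact: cexp_neq0.
  by apply: derivableB dhc _; exact: derivable_cst.
have per (x : R) : g (x +i* (pi *+ 2)) = g (x +i* 0).
  have E : cexp (x +i* (pi *+ 2)) = cexp (x +i* 0).
    by rewrite /cexp /= cos2pi sin2pi cos0 sin0.
  by rewrite /g E.
have gE (s : C) : cmod (g s) = cmod D * (cmod (h (cexp s) - h 0) / expR (complex.Re s)).
  rewrite /g !cmodM cmodV cmod_cexp; congr (_ * _).
  by rewrite /cmod; case: (D) => x y; rewrite !normc_def /= sqrrN.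
have H1 (y : R) : `|complex.Re (g (b +i* y)) - 0| <= cmod D * (4 * M / d).
  rewrite subr0; apply: (le_trans (Re_le_cmod _)); rewrite gE /= eb.
  rewrite ler_pM2l // ler_pdivrMr; last by rewrite divr_gt0.
  apply: (le_trans (cmodB _ _)).
  have -> : 4 * M / d * (d / 2) = M + M by field; exact: lt0r_neq0.
  by rewrite lerD // hM ?cmod0 // cmod_cexp /= eb; lra.
have H2 (y : R) : `|complex.Re (g (a +i* y)) - cmod D ^+ 2| <= e * cmod D.
  set w : C := cexp (a +i* y).
  have wr : cmod w < r by rewrite cmod_cexp.
  have w0 : w != 0 by exact: cexp_neq0.
  have := Hr w; rewrite subr0 => /(_ wr) Hw.
  have E : g (a +i* y) - (cmod D ^+ 2)%:C = conjc D * ((h w - h 0 - D * w) / w).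
    rewrite mulrBl mulfK // mulrBr; congr (_ - _).
    by rewrite cmodE; case: (D) => p q; apply/eqP; rewrite eq_complex /=;
      apply/andP; split; apply/eqP; ring.
  have -> : complex.Re (g (a +i* y)) - cmod D ^+ 2 = complex.Re (g (a +i* y) - (cmod D ^+ 2)%:C).
    by rewrite raddfB.
  apply: (le_trans (Re_le_cmod _)); rewrite E !cmodM cmodV.
  have -> : cmod (conjc D) = cmod D by rewrite /cmod; case: (D) => p q; rewrite !normc_def /= sqrrN.
  by rewrite mulrC ler_pM2r // ler_pdivrMr // cmod_gt0.
have := mean_value_periodic ab dg per H1 H2.
rewrite sub0r normrN ger0_norm ?sqr_ge0 // (mulrC e) -mulrDr expr2.
by rewrite ler_pM2l.
Qed.

End MeanValue.

(** * Topology of the projective space *)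

Lemma sum_continuous_at (T : topologicalType) (K : numFieldType)
    (V : normedModType K) (I : Type) (r : seq I) (f : I -> T -> V) (x : T) :
  (forall i, {for x, continuous (f i)}) ->
  {for x, continuous (fun y => \sum_(i <- r) f i y)}.
Proof.
move=> cf; elim: r => [|i r IH].
  have -> : (fun y => \sum_(i <- [::]) f i y) = cst 0.
    by apply/funext => y; rewrite big_nil.
  exact: cst_continuous.
have -> : (fun y => \sum_(j <- i :: r) f j y) = f i + (fun y => \sum_(j <- r) f j y).
  by apply/funext => y; rewrite big_cons.
exact: continuousD.
Qed.

Lemma prod_continuous_at (T : topologicalType) (K : numFieldType) (I : Type)
    (r : seq I) (f : I -> T -> K) (x : T) :
  (forall i, {for x, continuous (f i)}) ->
  {for x, continuous (fun y => \prod_(i <- r) f i y)}.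
Proof.
move=> cf; elim: r => [|i r IH].
  have -> : (fun y => \prod_(i <- [::]) f i y) = cst 1.
    by apply/funext => y; rewrite big_nil.
  exact: cst_continuous.
have -> : (fun y => \prod_(j <- i :: r) f j y) = f i * (fun y => \prod_(j <- r) f j y).
  by apply/funext => y; rewrite big_cons.
exact: continuousM.
Qed.

Lemma exp_continuous_at (T : topologicalType) (K : numFieldType)
    (f : T -> K) n (x : T) :
  {for x, continuous f} -> {for x, continuous (fun y => f y ^+ n)}.
Proof.
move=> cf; elim: n => [|n IH]; first exact: cst_continuous.
have -> : (fun y => f y ^+ n.+1) = f * (fun y => f y ^+ n).
  by apply/funext => y; rewrite exprS.
exact: continuousM.
Qed.

Section ProjectiveTopology.
Variables (R : realType) (N : nat).
Local Notation C := (Cplx R).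
Local Notation V := 'rV[C]_N.+1.
Local Notation Pn := (Pn R N).
Implicit Types (v w : V) (p q : Pn).

Definition punct v (v0 : v != 0) : punctured R N :=
  SigSub (mem_set (v0 : [set v : V | v != 0] v)).

Lemma homog_neq0 p : homog p != 0.
Proof. exact: set_valP (repr p). Qed.

Lemma coordsP v p : reflect (exists2 c : C, c != 0 & v = c *: homog p) (coords v p).
Proof.
apply: (iffP idP) => [/andP[/sub_rVP[c vE] /sub_rVP[d hE]] | [c c0 ->]].
  exists c => //; apply: contra_neq (homog_neq0 p) => c0.
  by rewrite hE vE c0 scale0r scaler0.
by apply/eqmxP/eqmx_scale.
Qed.

Lemma coords_homog p : coords (homog p) p.
Proof. by rewrite /coords submx_refl. Qed.

Lemma coords_neq0 v p : coords v p -> v != 0.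
Proof. by move=> /coordsP[c c0 ->]; rewrite scaler_eq0 negb_or c0 homog_neq0. Qed.

Lemma coordsZ v p (c : C) : c != 0 -> coords v p -> coords (c *: v) p.
Proof.
move=> c0 /coordsP[d d0 ->]; apply/coordsP; exists (c * d); last by rewrite scalerA.
by rewrite mulf_neq0.
Qed.

Lemma coords_pi (u : punctured R N) : coords (set_val u) (\pi_Pn u)%qT.
Proof.
suff : proportional u (repr (\pi_Pn u)%qT) by [].
by apply/(@eqmodP _ (proportional_equiv R N)); rewrite reprK.
Qed.

Lemma coords_ex v : v != 0 -> exists p, coords v p.
Proof.
move=> v0; exists (\pi_Pn (punct v0))%qT.
exact: (coords_pi (punct v0)).
Qed.

Lemma coords_inj v p q : coords v p -> coords v q -> p = q.
Proof.
move=> /andP[vp pv] /andP[vq qv].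
rewrite -(reprK p) -(reprK q); apply/(@eqmodP _ (proportional_equiv R N)).
by rewrite /= /proportional (submx_trans pv vq) (submx_trans qv vp).
Qed.

(** Moves a neighbourhood from the quotient to the vector space, where the compactness and lifting
    arguments take place. *)
Lemma coords_near (A : set Pn) p v : nbhs p A -> coords v p ->
  \forall w \near v, forall q, coords w q -> A q.
Proof.
rewrite nbhsE => -[U [oU Up] UA] vp.
have [U' oU' UE] : open ((\pi_Pn : punctured R N -> Pn)%qT @^-1` U) := oU.
have piE w q (w0 : w != 0) : coords w q -> U' w -> U q.
  move=> wq U'w; pose u : punctured R N := punct w0.
  have -> : q = (\pi_Pn u)%qT by apply: coords_inj wq _; exact: (coords_pi u).
  have : ((\pi_Pn : punctured R N -> Pn)%qT @^-1` U) u by rewrite -UE.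
  by [].
have : nbhs v U'.
  apply: open_nbhs_nbhs; split => //.
  have v0 := coords_neq0 vp; pose u : punctured R N := punct v0.
  have E : p = (\pi_Pn u)%qT by apply: coords_inj vp _; exact: (coords_pi u).
  have : ((\pi_Pn : punctured R N -> Pn)%qT @^-1` U) u by rewrite /preimage /= -E.
  by rewrite -UE.
apply: filterS => w U'w q wq; apply: UA.
exact: piE (coords_neq0 wq) wq U'w.
Qed.

(** Invariance under scaling makes the composite with the projection equal to [f] itself, and the
    universal property of the quotient topology applies. *)
Lemma homog_continuous (T : topologicalType) (f : V -> T) :
  (forall v, v != 0 -> {for v, continuous f}) ->
  (forall v (c : C), v != 0 -> c != 0 -> f (c *: v) = f v) ->
  continuous (fun p => f (homog p)).
Proof.
move=> cf fZ; apply/quotient_continuous => u.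
have E : (fun p => f (homog p)) \o (\pi_Pn : punctured R N -> Pn)%qT = f \o set_val.
  apply/funext => u' /=; have /coordsP[c c0 ->] := coords_pi u'.
  by rewrite fZ // homog_neq0.
rewrite E; apply: continuous_comp.
  exact: initial_continuous.
apply: cf; exact: set_valP u.
Qed.

Lemma coords_scale_invariant (T : Type) (f : V -> T) v p :
  (forall v (c : C), v != 0 -> c != 0 -> f (c *: v) = f v) ->
  coords v p -> f (homog p) = f v.
Proof. by move=> fZ /coordsP[c c0 ->]; rewrite fZ // homog_neq0. Qed.

Lemma cmod_continuous : continuous (@cmod R : C -> R).
Proof.
move=> z; apply: (iffRL (@cvgrPdist_le _ _ _ (nbhs z) (nbhs_filter z) _ _)) => e e0.
apply/near_cmodP; exists e => // w we.
rewrite -normrN opprB ler_norml; apply/andP; split.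
  rewrite -subr_ge0; have := cmodD (z - w) w; rewrite subrK cmod_distC; lra.
by have := cmodD (w - z) z; rewrite subrK; lra.
Qed.

Lemma compact_unit_square :
  compact [set z : C | -1 <= complex.Re z <= 1 /\ -1 <= complex.Im z <= 1].
Proof.
have -> : [set z : C | -1 <= complex.Re z <= 1 /\ -1 <= complex.Im z <= 1] =
   (fun p : R * R => (p.1 +i* p.2 : C)) @` (`[-1, 1] `*` `[-1, 1]).
  apply/seteqP; split => [[x y] /= [xx yy] | _ [[x y] /= [xx yy] <-]].
    by exists (x, y) => //=; rewrite !in_itv.
  by move: xx yy; rewrite !in_itv.
apply: continuous_compact.
  apply: continuous_subspaceT => p.
  apply: (iffRL (@cvgrPdist_le C C _ (nbhs p) (nbhs_filter p) _ _)) => e e0.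
  have er : e = (complex.Re e)%:C.
    by case: (e) e0 => a b; rewrite ltcE /= => /andP[/eqP -> _].
  have e1 : 0 < complex.Re e by rewrite -ltcR -er.
  have e2 : 0 < complex.Re e / 2 by rewrite divr_gt0.
  have c1 : \forall q \near p, `|p.1 - q.1| <= complex.Re e / 2.
    have : fst @ nbhs p --> p.1 by exact: cvg_fst.
    by move/(iffLR (@cvgrPdist_le _ _ _ (nbhs p) (nbhs_filter p) _ _)); exact.
  have c2 : \forall q \near p, `|p.2 - q.2| <= complex.Re e / 2.
    have : snd @ nbhs p --> p.2 by exact: cvg_snd.
    by move/(iffLR (@cvgrPdist_le _ _ _ (nbhs p) (nbhs_filter p) _ _)); exact.
  apply: filterS2 c1 c2 => q q1 q2.
  rewrite normC_cmod er lecR; apply: (le_trans (cmod_le_ReIm _)) => /=; lra.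
by apply: compact_setX; exact: segment_compact.
Qed.

(** Compactness of [P^N] in near-covering form: the compact sets [K k] of vectors with [k]-th
    coordinate 1 and the others in a square meet every line through 0. *)
Lemma Pn_near_covering (I : Type) (F : set_system I) (P : I -> Pn -> Prop) :
  Filter F -> (forall p, \forall p' \near p & i \near F, P i p') ->
  \forall i \near F, forall p, P i p.
Proof.
move=> FF cov.
pose A (k j : 'I_N.+1) : set C := if j == k then [set 1] else
  [set z : C | -1 <= complex.Re z <= 1 /\ -1 <= complex.Im z <= 1].
pose K k := [set v : V | forall j, A k j (v ord0 j)].
have cK k : compact (K k).
  apply: rV_compact => j; rewrite /A; case: ifP => _; first exact: compact_set1.
  exact: compact_unit_square.
have H k : \forall i \near F, forall v, K k v -> forall p, coords v p -> P i p.
  have /compact_near_coveringP/(_ I F (fun i v => forall p, coords v p -> P i p) FF) := cK k.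
  apply => v Kv.
  have v0 : v != 0.
    have := Kv k; rewrite /A eqxx /= => vk.
    by apply: contraTneq (oner_neq0 C) => vE; rewrite -vk vE mxE eqxx.
  have [p vp] := coords_ex v0.
  have [[/= B D] [Bp FD] BD] := cov p.
  exists ([set w | forall q, coords w q -> B q], D).
    by split => //=; exact: coords_near vp.
  by move=> [w i] /= [wB Di] q wq; apply: (BD (q, i)); split => //=; exact: wB.
have : \forall i \near F, forall k v, K k v -> forall p, coords v p -> P i p.
  exact: filter_forall.
apply: filterS => i Hi p.
(* Dividing by a coordinate of largest modulus brings all the others into the unit disc, hence into
   the square. *)
pose k := [arg max_(k > ord0) cmod (homog p 0 k)]%O.
have kmax j : cmod (homog p 0 j) <= cmod (homog p 0 k).
  by rewrite /k; case: arg_maxP => // m _; exact.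
have hk : homog p 0 k != 0.
  apply: contra_neq (homog_neq0 p) => hk0; apply/rowP => j; rewrite mxE.
  by apply/eqP; rewrite -cmod_eq0 eq_le cmod_ge0 andbT -(cmod0 R) -hk0 kmax.
apply: (Hi k ((homog p 0 k)^-1 *: homog p)); last first.
  by apply: coordsZ (coords_homog p); rewrite invr_eq0.
move=> j; rewrite mxE /A; case: eqVneq => [->|_] /=; first by rewrite mulVf.
have le1 : cmod ((homog p 0 k)^-1 * homog p 0 j) <= 1.
  by rewrite cmodM cmodV mulrC ler_pdivrMr ?mul1r ?cmod_gt0.
have := Re_le_cmod ((homog p 0 k)^-1 * homog p 0 j).
have := Im_le_cmod ((homog p 0 k)^-1 * homog p 0 j).
by rewrite !ler_norml => /andP[? ?] /andP[? ?]; split; apply/andP; split; lra.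
Qed.

Lemma peval_continuous (Q : mpoly.mpoly N.+1 C) : continuous (peval Q : V -> C).
Proof.
move=> v.
have -> : peval Q = fun w : V => \sum_(m <- mpoly.msupp Q)
    (mpoly.mcoeff m Q * \prod_(i < N.+1) w 0 i ^+ m i).
  by apply/funext => w; rewrite /peval mpoly.mevalE.
apply: sum_continuous_at => m; apply: continuousM; first exact: cst_continuous.
by apply: prod_continuous_at => i; apply: exp_continuous_at; exact: coord_continuous.
Qed.

Lemma peval_homogeneous d (Q : mpoly.mpoly N.+1 C) (c : C) v :
  homogeneous d Q -> peval Q (c *: v) = c ^+ d * peval Q v.
Proof.
move=> hQ; rewrite /peval !mpoly.mevalE mulr_sumr big_seq [RHS]big_seq.
apply: eq_bigr => m mQ.
have <- : mpoly.mdeg m = d := mpoly.dhomog_mf hQ mQ.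
rewrite mulrCA; congr (_ * _); rewrite mpoly.mdegE -prodrXr -big_split /=.
by apply: eq_bigr => i _; rewrite mxE exprMn.
Qed.

Lemma algebraic_closed (A : set Pn) : algebraic A -> closed A.
Proof.
move=> [S hS ->]; rewrite /zero_locus.
have -> : [set p : Pn | forall Q, S Q -> peval Q (homog p) = 0] =
   \bigcap_(Q in S) [set p : Pn | peval Q (homog p) = 0].
  by apply/seteqP; split => p /= H Q; apply: H.
apply: closed_bigI => Q SQ; have [d hQ] := hS Q SQ.
rewrite -openC.
have o : open (peval Q @^-1` [set z : C | z != 0]).
  apply: open_comp => [v _|]; first exact: peval_continuous.
  rewrite openE => z /= z0; apply/near_cmodP; exists (cmod z); first by rewrite cmod_gt0.
  by move=> w; apply: contraTneq => ->; rewrite sub0r cmodN ltxx.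
exists (peval Q @^-1` [set z : C | z != 0]) => //.
apply/seteqP; split => u /=; have /coordsP[c c0 ->] := coords_pi u;
  rewrite (peval_homogeneous _ _ hQ).
  by move=> /eqP H K; apply: H; rewrite K mulr0.
by move=> /eqP H; rewrite mulf_neq0 // expf_neq0.
Qed.

End ProjectiveTopology.

(** * The Fubini-Study form *)

Section FubiniStudy.
Variables (R : realType) (N : nat).
Local Notation C := (Cplx R).
Local Notation V := 'rV[C]_N.+1.
Implicit Types (a b v : V) (G : 'M[C]_N.+1).

Definition herm a b : C := \sum_i a 0 i * (b 0 i)^*.

(** Entry [(j, k)] is the mixed derivative of [log |v|^2] in [v_j] and the conjugate of [v_k]. *)
Definition fubini_study v : 'M[C]_N.+1 :=
  \matrix_(j, k) ((herm v v * (j == k)%:R - (v 0 j)^* * v 0 k) / herm v v ^+ 2).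

Lemma hermC a b : (herm a b)^* = herm b a.
Proof.
by rewrite /herm rmorph_sum; apply: eq_bigr => i _; rewrite rmorphM /= conjCK mulrC.
Qed.

Lemma hermDl a b v : herm (a + b) v = herm a v + herm b v.
Proof. by rewrite /herm -big_split; apply: eq_bigr => i _; rewrite mxE mulrDl. Qed.

Lemma hermZl (c : C) a b : herm (c *: a) b = c * herm a b.
Proof. by rewrite /herm mulr_sumr; apply: eq_bigr => i _; rewrite mxE mulrA. Qed.

Lemma hermZr (c : C) a b : herm a (c *: b) = c^* * herm a b.
Proof. by rewrite -hermC hermZl rmorphM /= hermC. Qed.

Lemma hermE a : herm a a = \sum_i `|a 0 i| ^+ 2.
Proof. by apply: eq_bigr => i _; rewrite normCK. Qed.

Lemma herm_ge0 a : 0 <= herm a a.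
Proof. by rewrite hermE sumr_ge0 // => i _; rewrite exprn_ge0. Qed.

Lemma herm_gt0 a : (0 < herm a a) = (a != 0).
Proof.
rewrite lt0r herm_ge0 andbT; congr (~~ _); apply/eqP/eqP => [|->]; last first.
  by rewrite /herm big1 // => i _; rewrite mxE mul0r.
rewrite hermE => /eqP; rewrite psumr_eq0 => [/allP h|i _]; last by rewrite exprn_ge0.
apply/rowP => i; rewrite mxE; apply/eqP.
by have := h i (mem_index_enum i); rewrite expf_eq0 normr_eq0.
Qed.

Lemma hformE G a b : hform G a b = \sum_k (a *m G) 0 k * (b 0 k)^*.
Proof. by rewrite /hform mxE; apply: eq_bigr => k _; rewrite !mxE. Qed.

Lemma hformZ (c : C) G a b : hform (c *: G) a b = c * hform G a b.
Proof. by rewrite /hform -scalemxAr -scalemxAl mxE. Qed.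

Lemma fubini_study_mul a v k : (a *m fubini_study v) 0 k =
  (herm v v * a 0 k - herm a v * v 0 k) / herm v v ^+ 2.
Proof.
rewrite mxE.
have E j : a 0 j * fubini_study v j k = (herm v v * (a 0 j * (j == k)%:R) -
    a 0 j * (v 0 j)^* * v 0 k) / herm v v ^+ 2 by rewrite mxE; ring.
rewrite (eq_bigr _ (fun j _ => E j)).
rewrite -mulr_suml sumrB -mulr_sumr.
have -> : \sum_j a 0 j * (j == k)%:R = a 0 k.
  rewrite (bigD1 k) //= eqxx mulr1 big1 ?addr0 // => j /negbTE ->.
  by rewrite mulr0.
by rewrite -mulr_suml.
Qed.

Lemma hform_fubini_study v a b : hform (fubini_study v) a b =
  (herm v v * herm a b - herm a v * herm v b) / herm v v ^+ 2.
Proof.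
rewrite hformE; under eq_bigr do rewrite fubini_study_mul.
rewrite /herm !mulr_sumr -sumrB mulr_suml; apply: eq_bigr => k _.
by rewrite -!/(herm _ _); ring.
Qed.

Lemma fubini_study_hermitian v j k :
  fubini_study v k j = (fubini_study v j k)^*.
Proof.
rewrite !mxE eq_sym fmorph_div rmorphXn rmorphB !rmorphM /= rmorph_nat conjCK hermC.
by rewrite [v 0 j * _]mulrC.
Qed.

Lemma fubini_study_kernel v : v *m fubini_study v = 0.
Proof. by apply/rowP => k; rewrite fubini_study_mul mxE subrr mul0r. Qed.

Lemma fubini_studyZ v (c : C) : v != 0 -> c != 0 ->
  fubini_study (c *: v) = `|c| ^- 2 *: fubini_study v.
Proof.
move=> v0 c0; have h0 : herm v v != 0 by rewrite lt0r_neq0 // herm_gt0.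
have c0' : c^* != 0 by rewrite conjC_eq0.
apply/matrixP => j k; rewrite !mxE hermZl hermZr normCK rmorphM /=.
by field; rewrite h0 c0 c0'.
Qed.

(** Independence of the lift: multiplying a lift by a nonvanishing function changes its value to
    [c *: v] and its derivative to [c *: a + e *: v]. *)
Lemma hform_fubini_study_move v a (c e : C) : v != 0 -> c != 0 ->
  hform (fubini_study (c *: v)) (c *: a + e *: v) (c *: a + e *: v) =
  hform (fubini_study v) a a.
Proof.
move=> v0 c0; have h0 : herm v v != 0 by rewrite lt0r_neq0 // herm_gt0.
have c0' : c^* != 0 by rewrite conjC_eq0.
have hD x y z : herm x (y + z) = herm x y + herm x z.
  by rewrite -hermC hermDl rmorphD /= !hermC.
rewrite fubini_studyZ // hformZ !hform_fubini_study !(hermDl, hD, hermZl, hermZr) normCK.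
by field; rewrite h0 c0 c0'.
Qed.

Lemma hform_fubini_study_gt0 v a : v != 0 -> ~~ (a <= v)%MS ->
  0 < hform (fubini_study v) a a.
Proof.
move=> v0 nav; have h0 : herm v v != 0 by rewrite lt0r_neq0 // herm_gt0.
(* The component of [a] orthogonal to [v]; on it the form is the Euclidean one divided by
   [herm v v]. *)
pose b := a - (herm a v / herm v v) *: v.
have b0 : b != 0.
  apply: contra nav; rewrite subr_eq0 => /eqP ->; exact: scalemx_sub.
have -> : hform (fubini_study v) a a = hform (fubini_study v) b b.
  have := @hform_fubini_study_move v a 1 (- (herm a v / herm v v)) v0 (oner_neq0 _).
  by rewrite !scale1r scaleNr -/b => ->.
have bv : herm b v = 0.
  by rewrite /b -scaleNr hermDl hermZl; field.
by rewrite hform_fubini_study bv mul0r subr0 divr_gt0 ?mulr_gt0 ?exprn_gt0 ?herm_gt0.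
Qed.

Lemma hform_fubini_study_le v a : v != 0 ->
  hform (fubini_study v) a a <= herm a a / herm v v.
Proof.
move=> v0; have h0 : herm v v != 0 by rewrite lt0r_neq0 // herm_gt0.
rewrite hform_fubini_study mulrBl.
have -> : herm v v * herm a a / herm v v ^+ 2 = herm a a / herm v v by field.
rewrite gerBl divr_ge0 ?exprn_ge0 ?herm_ge0 //.
by rewrite -(hermC a v) -normCK exprn_ge0.
Qed.

End FubiniStudy.

(** * Discs in a hyperbolically imbedded complement *)

Section UniformBound.
Variables (R : realType) (N : nat).
Local Notation C := (Cplx R).
Local Notation V := 'rV[C]_N.+1.
Local Notation Pn := (Pn R N).

Definition local_lift (F : C -> V) (g : C -> Pn) (z : C) :=
  \forall w \near z, derivable F w 1 /\ coords (F w) (g w).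

Lemma is_derive_coord (F : C -> V) (z : C) j : derivable F z 1 ->
  is_derive z (1 : C) (fun w => F w 0 j) (('D_1 F z) 0 j).
Proof.
move=> /cvg_ex[l Fl].
have lE : 'D_1 F z = l by apply: (cvg_lim (@norm_hausdorff _ _) Fl).
have cl : (fun h => h^-1 *: (((fun w => F w 0 j) \o shift z) (h *: (1 : C)) - F z 0 j))
    @ (0 : C)^' --> (l 0 j : C).
  have -> : (fun h => h^-1 *: (((fun w => F w 0 j) \o shift z) (h *: (1 : C)) - F z 0 j)) =
     (fun M : V => M 0 j) \o (fun h : C => h^-1 *: ((F \o shift z) (h *: (1 : C)) - F z)).
    by apply/funext => h; rewrite /= !mxE.
  by apply: cvg_comp Fl _; exact: coord_continuous.
apply: DeriveDef; first by apply/cvg_ex; exists (l 0 j).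
by rewrite lE; exact: (cvg_lim (@norm_hausdorff _ _) cl).
Qed.

Definition affine_coord (i j : 'I_N.+1) (p : Pn) : C := homog p 0 j / homog p 0 i.

(** Valid off the chart as well, because [0^-1 = 0] makes both sides vanish there. *)
Lemma affine_coordE i j v p : coords v p -> affine_coord i j p = v 0 j / v 0 i.
Proof.
move=> /coordsP[c c0 ->]; rewrite !mxE /affine_coord.
have [->|h0] := eqVneq (homog p 0 i) 0; first by rewrite mulr0 !invr0 !mulr0.
by field; rewrite h0 c0.
Qed.

Lemma is_derive_affine_coord (F : C -> V) g z i j : local_lift F g z ->
  F z 0 i != 0 ->
  is_derive z (1 : C) (fun w => affine_coord i j (g w))
    ((('D_1 F z) 0 j - F z 0 j / F z 0 i * ('D_1 F z) 0 i) / F z 0 i).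
Proof.
move=> Fg Fi0; have [dF _] := nbhs_singleton Fg.
have [di Ei] := is_derive_coord i dF; have [dj Ej] := is_derive_coord j dF.
apply: (@near_eq_is_derive _ _ _ (fun w => F w 0 j * (F w 0 i)^-1)).
  by apply: filterS Fg => w [_ /affine_coordE ->].
apply: DeriveDef; first exact: (derivableM dj (derivableV Fi0 di)).
have -> : 'D_1 (fun w => F w 0 j * (F w 0 i)^-1) z = _ := deriveM dj (derivableV Fi0 di).
rewrite (deriveV Fi0 di) Ei Ej /GRing.scale /=.
by field.
Qed.

(** The affine lift [F / F_i] has a coordinate equal to 1, hence norm at least 1, so its
    Fubini-Study length is bounded by the Euclidean one. *)
Lemma fubini_study_affine (F : C -> V) g i : local_lift F g 0 -> F 0 0 i != 0 ->
  complex.Re (hform (fubini_study (F 0)) ('D_1 F 0) ('D_1 F 0)) <=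
  \sum_j cmod ('D_1 (fun w => affine_coord i j (g w)) 0) ^+ 2.
Proof.
move=> Fg Fi0.
pose h : V := \row_j (F 0 0 j / F 0 0 i).
pose h' : V := \row_j ('D_1 (fun w => affine_coord i j (g w)) 0).
have FE : F 0 = F 0 0 i *: h by apply/rowP => j; rewrite !mxE; field.
(* Leibniz rule for [F = F_i * h], in the shape required by [hform_fubini_study_move]. *)
have F'E : 'D_1 F 0 = F 0 0 i *: h' + ('D_1 F 0) 0 i *: h.
  apply/rowP => j; rewrite !mxE.
  by have [_ ->] := is_derive_affine_coord j Fg Fi0; field.
have h0 : h != 0.
  by apply: contraNneq Fi0 => hh; rewrite FE hh scaler0 mxE.
rewrite {1}FE F'E hform_fubini_study_move //.
have H1 : 1 <= herm h h.
  rewrite hermE (bigD1 i) //= mxE divff // normr1 expr1n lerDl.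
  by rewrite sumr_ge0 // => j _; rewrite exprn_ge0.
have H2 : hform (fubini_study h) h' h' <= herm h' h'.
  apply: le_trans (hform_fubini_study_le h' h0) _.
  by rewrite ler_pdivrMr ?(lt_le_trans ltr01) // ler_peMr ?herm_ge0.
have : complex.Re (hform (fubini_study h) h' h') <= complex.Re (herm h' h').
  by move: H2; rewrite lecE => /andP[].
move=> /le_trans; apply; rewrite le_eqVlt; apply/orP; left; apply/eqP.
rewrite hermE raddf_sum; apply: eq_bigr => j _.
by rewrite /h' mxE normC_cmod -rmorphXn.
Qed.

Lemma lift_continuous (T : topologicalType) (f : V -> T) (F : C -> V) (g : C -> Pn) z :
  (forall v, v != 0 -> {for v, continuous f}) ->
  (forall v (c : C), v != 0 -> c != 0 -> f (c *: v) = f v) ->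
  local_lift F g z -> {for z, continuous (fun w => f (homog (g w)))}.
Proof.
move=> cf fZ Fg; have [dF Fz] := nbhs_singleton Fg.
have E : \forall w \near z, f (F w) = f (homog (g w)).
  by apply: filterS Fg => w [_ cw]; rewrite (coords_scale_invariant fZ cw).
rewrite /prop_for /continuous_at /= (coords_scale_invariant fZ Fz).
apply: cvg_trans (near_eq_cvg E) _.
apply: (@continuous_comp _ _ _ F f).
  by apply: differentiable_continuous; apply/derivable1_diffP.
exact: cf (coords_neq0 Fz).
Qed.

Lemma poincare_small (e : R) : 0 < e -> \forall n \near \oo, forall z : C,
  cmod z < n.+1%:R^-1 -> poincare 0 z < e.
Proof.
move=> e0.
have E1 : 1 < expR e by rewrite -expR0 ltr_expR.
(* This is [tanh (e / 2)], the Euclidean radius of the Poincare disc of radius [e] about 0. *)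
have k0 : 0 < (expR e - 1) / (expR e + 1) by rewrite divr_gt0 //; lra.
near=> n => z zn.
have zk : cmod z < (expR e - 1) / (expR e + 1).
  by apply: (lt_trans zn); near: n; exact: near_infty_natSinv_lt (PosNum k0).
have z0 := cmod_ge0 z.
rewrite ltr_pdivlMr in zk; last by lra.
have z1 : cmod z < 1.
  by rewrite -(@ltr_pM2r _ (expR e + 1)); lra.
rewrite /poincare mulr0 subr0 divr1 sub0r cmodN.
have -> : e = ln (expR e) by rewrite expRK.
rewrite ltr_ln ?posrE ?expR_gt0 ?divr_gt0; try lra.
rewrite ltr_pdivrMr; lra.
Unshelve. all: by end_near. Qed.

Lemma ereal_gt0_le (x : \bar R) : (0 < x)%E -> exists2 e : R, 0 < e & (e%:E <= x)%E.
Proof.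
case: x => [r| |] // x0; first by exists r; rewrite ?lte_fin in x0 *.
by exists 1; rewrite ?ltr01 ?leey.
Qed.

Variables (X : set Pn) (D : set Pn).
Hypothesis Xclosed : closed X.
Hypothesis imbedded : hyperbolically_imbedded X D.
Local Notation Y := (X `\` D).

(** A single disc is already a Kobayashi chain, so the distance from [g 0] to [g z] is at most
    [poincare 0 z]. If that is below the distance separating neighbourhoods of [p] and of a zero
    [q], then [g z] cannot be near [q]. *)
Lemma discs_avoid (f : V -> R) (p : Pn) :
  (forall v, v != 0 -> {for v, continuous f}) ->
  (forall v (c : C), v != 0 -> c != 0 -> f (c *: v) = f v) ->
  f (homog p) != 0 ->
  \forall p' \near p & n \near \oo, forall g : C -> Pn,
    holomorphic_map (@unit_disc R) g -> (forall z, unit_disc z -> Y (g z)) ->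
    g 0 = p' -> forall z, cmod z < n.+1%:R^-1 -> f (homog (g z)) != 0.
Proof.
move=> cf fZ fp.
(* The value [q] of the disc is a separate variable, so that the covering argument can run over
   it. *)
pose P (i : Pn * nat) (q : Pn) := forall g : C -> Pn,
    holomorphic_map (@unit_disc R) g -> (forall z, unit_disc z -> Y (g z)) ->
    g 0 = i.1 -> forall z, cmod z < i.2.+1%:R^-1 -> g z = q -> f (homog q) != 0.
suff : \forall i \near filter_prod (nbhs p) \oo, forall q, P i q.
  by apply: filterS => -[p' n] H g hg gY gp z zn; exact: H hg gY gp z zn erefl.
apply: Pn_near_covering => q.
have cF := homog_continuous cf fZ.
have [fq|fq] := eqVneq (f (homog q)) 0; last first.
  have : \forall q' \near q, f (homog q') != 0.
    apply: (cF q [set x : R | x != 0]).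
    apply: (@open_nbhs_nbhs R _ [set x : R | x != 0]); split; [exact: open_neq | exact: fq].
  move=> H; exists ([set q' | f (homog q') != 0], setT) => /=; first by split => //; exact: filterT.
  by move=> [q' i] [/= H' _] g _ _ _ z _ _.
have pq : p != q by apply: contraNneq fp => ->; rewrite fq.
have in_disc n (z : C) : cmod z < n.+1%:R^-1 -> unit_disc z.
  by move=> /lt_le_trans; apply; rewrite invf_le1 ?ltr0n // ler1n.
have d0 : @unit_disc R 0 by rewrite /unit_disc /= cmod0.
have YX : closure Y `<=` X.
  have XE : X = closure X by apply/closure_id.
  by rewrite [Z in _ `<=` Z]XE; apply: closureS; exact: subDsetl.
have miss r : ~ closure Y r -> \forall r' \near r, ~ Y r'.
  move=> /existsNP[B /not_implyP[Br nB]]; apply: filterS Br => r' Br' Yr'.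
  by apply: nB; exists r'.
(* Hyperbolic imbedding speaks only of points of [X] in the closure of [Y]. A point outside this
   closure has a neighbourhood missing [Y], where no disc in [Y] can start or pass. *)
have [cp|/miss np] := pselect (closure Y p); last first.
  exists (setT, [set i | ~ Y i.1]) => /=.
    split; first exact: filterT.
    exists ([set r | ~ Y r], setT) => /=; first by split => //; exact: filterT.
    by move=> [] /= r n [].
  move=> [q' i] [/= _ nYi] g _ gY gi z _ _; case: nYi; rewrite -gi; exact: gY.
have [cq|/miss nq] := pselect (closure Y q); last first.
  exists ([set r | ~ Y r], setT) => /=; first by split => //; exact: filterT.
  move=> [q' i] [/= nYq _] g _ gY gi z zi gz; case: nYq; rewrite -gz; apply: gY.
  exact: in_disc zi.
have [_ /(_ p q (conj (YX _ cp) cp) (conj (YX _ cq) cq) pq)] := imbedded.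
move=> [Up [Uq [nUp nUq /ereal_gt0_le[e e0 de]]]].
have /poincare_small small := e0.
exists (Uq, [set i | Up i.1 /\ forall z : C, cmod z < i.2.+1%:R^-1 -> poincare 0 z < e]) => /=.
  split => //.
  by exists (Up, [set n | forall z : C, cmod z < n.+1%:R^-1 -> poincare 0 z < e]).
move=> [q' [p' n]] [/= Uq' [Up' sm]] g hg gY gp z zn gz.
have zd := in_disc _ _ zn.
exfalso; have := sm _ zn; apply/negP; rewrite -leNgt -lee_fin.
apply: (le_trans de); apply: (@le_trans _ _ (kobayashi_dist Y (g 0) (g z))).
  apply: ereal_inf_lbound; exists (g 0, g z) => //=.
  by rewrite gp gz; split; split => //; [rewrite -gp | rewrite -gz]; exact: gY.
apply: ereal_inf_lbound; exists (poincare 0 z) => //.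
rewrite -[poincare 0 z]addr0.
apply: (@kobayashi_cons _ _ Y g 0 z) => //.
by apply: kobayashi_nil; exact: gY.
Qed.

End UniformBound.

(** * A uniform bound for the derivatives of discs *)

Section Brody.
Variables (R : realType) (N : nat).
Local Notation C := (Cplx R).
Local Notation V := 'rV[C]_N.+1.
Local Notation Pn := (Pn R N).

Definition l1norm (v : V) : R := \sum_j cmod (v 0 j).

(* Normalised to be homogeneous of degree 0; it is negative exactly on the
   polydisc [sum_j |v_j / v_i - a_j| < 1] of the affine chart [v_i != 0]. *)
Definition polydisc_fun (a : V) (i : 'I_N.+1) (v : V) : R :=
  ((\sum_j cmod (v 0 j - v 0 i * a 0 j)) - cmod (v 0 i)) / l1norm v.

Lemma l1norm_gt0 v : v != 0 -> 0 < l1norm v.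
Proof.
move=> v0; rewrite lt0r sumr_ge0 ?andbT => [|j _]; last exact: cmod_ge0.
apply: contra v0; rewrite psumr_eq0 => [/allP h|j _]; last exact: cmod_ge0.
apply/eqP/rowP => j; rewrite mxE; apply/eqP.
by have := h j (mem_index_enum j); rewrite cmod_eq0.
Qed.

Lemma l1normZ (c : C) v : l1norm (c *: v) = cmod c * l1norm v.
Proof. by rewrite /l1norm mulr_sumr; apply: eq_bigr => j _; rewrite mxE cmodM. Qed.

Lemma polydisc_funZ a i v (c : C) : v != 0 -> c != 0 ->
  polydisc_fun a i (c *: v) = polydisc_fun a i v.
Proof.
move=> v0 c0; rewrite /polydisc_fun l1normZ.
have -> : \sum_j cmod ((c *: v) 0 j - (c *: v) 0 i * a 0 j) =
   cmod c * \sum_j cmod (v 0 j - v 0 i * a 0 j).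
  by rewrite mulr_sumr; apply: eq_bigr => j _; rewrite !mxE -mulrA -mulrBr cmodM.
rewrite mxE cmodM -mulrBr.
have cc : cmod c != 0 by rewrite cmod_eq0.
have vv : l1norm v != 0 by rewrite lt0r_neq0 // l1norm_gt0.
by field; rewrite cc vv.
Qed.

Lemma polydisc_fun_continuous a i v : v != 0 -> {for v, continuous (polydisc_fun a i)}.
Proof.
move=> v0.
have cc (g : V -> C) : {for v, continuous g} -> {for v, continuous (fun w => cmod (g w))}.
  by move=> cg; apply: continuous_comp cg _; exact: cmod_continuous.
have cj j : {for v, continuous (fun w : V => w 0 j)} by exact: coord_continuous.
have cl : {for v, continuous l1norm}.
  by apply: sum_continuous_at => j; exact: cc.
have cn : {for v, continuous (fun w : V => \sum_j cmod (w 0 j - w 0 i * a 0 j))}.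
  apply: sum_continuous_at => j; apply: cc.
  apply: continuousB; first exact: cj.
  by apply: continuousM; [exact: cj | exact: cst_continuous].
apply: (@continuousM _ _ (fun w : V => _ - cmod (w 0 i)) (fun w => (l1norm w)^-1)).
  by apply: continuousB; [exact: cn | exact: cc].
by apply: continuousV => //; rewrite lt0r_neq0 // l1norm_gt0.
Qed.

Lemma polydisc_fun_lt0 a i v : v != 0 -> polydisc_fun a i v < 0 ->
  v 0 i != 0 /\ forall j, cmod (v 0 j / v 0 i) <= cmod (a 0 j) + 1.
Proof.
move=> v0; rewrite /polydisc_fun pmulr_llt0 ?invr_gt0 ?l1norm_gt0 // subr_lt0 => H.
have Hj j : cmod (v 0 j - v 0 i * a 0 j) < cmod (v 0 i).
  apply: le_lt_trans H; rewrite (bigD1 j) //= lerDl.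
  by apply: sumr_ge0 => k _; exact: cmod_ge0.
have vi : 0 < cmod (v 0 i) := le_lt_trans (cmod_ge0 _) (Hj i).
split=> [|j]; first by rewrite -cmod_gt0.
rewrite cmodM cmodV ler_pdivrMr // -[v 0 j](subrK (v 0 i * a 0 j)).
apply: (le_trans (cmodD _ _)); rewrite cmodM mulrDl mul1r addrC mulrC lerD2l.
exact: ltW.
Qed.

Variables (X D : set Pn).
Hypothesis Xclosed : closed X.
Hypothesis imbedded : hyperbolically_imbedded X D.
Local Notation Y := (X `\` D).

Lemma holomorphic_lift (g : C -> Pn) z : holomorphic_map (@unit_disc R) g ->
  unit_disc z -> exists F, local_lift F g z.
Proof. by move=> hg zd; have [F HF] := hg z zd; exists F. Qed.

(** By the intermediate value theorem on the segment from 0 to [z], the function cannot change sign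
    without a zero. This is the connectedness that confines the disc to the polydisc. *)
Lemma disc_stays (f : V -> R) (g : C -> Pn) (r : R) :
  (forall v, v != 0 -> {for v, continuous f}) ->
  (forall v (c : C), v != 0 -> c != 0 -> f (c *: v) = f v) ->
  holomorphic_map (@unit_disc R) g -> r <= 1 ->
  (forall z, cmod z < r -> f (homog (g z)) != 0) -> f (homog (g 0)) < 0 ->
  forall z, cmod z < r -> f (homog (g z)) < 0.
Proof.
move=> cf fZ hg r1 fn0 f0 z zr; rewrite ltNge; apply/negP => fz.
pose h (t : R) := f (homog (g (t%:C * z))).
have tr (t : R) : 0 <= t <= 1 -> cmod (t%:C * z) < r.
  move=> /andP[t0 t1]; rewrite cmodM cmod_real ger0_norm //.
  by apply: le_lt_trans zr; rewrite ler_piMl // cmod_ge0.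
have ch : {within `[0, 1], continuous h}.
  apply: continuous_in_subspaceT => t; rewrite inE /= in_itv /= => /tr tz.
  have [F Fg] := holomorphic_lift hg (lt_le_trans tz r1).
  apply: (@continuous_comp R C R (fun t : R => t%:C * z) (fun w => f (homog (g w)))).
    apply: (iffRL (@cvgrPdist_le C C _ (nbhs t) (nbhs_filter t) _ _)) => e e0.
    have er : e = (complex.Re e)%:C.
      by case: (e) e0 => a b; rewrite ltcE /= => /andP[/eqP -> _].
    have e1 : 0 < complex.Re e / (cmod z + 1).
      by rewrite divr_gt0 ?ltr_wpDl ?cmod_ge0 // -ltcR -er.
    near=> s; rewrite -mulrBl normC_cmod er lecR -rmorphB cmodM cmod_real.
    have zz : 0 < cmod z + 1 by rewrite ltr_wpDl ?cmod_ge0.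
    apply: (@le_trans _ _ (complex.Re e / (cmod z + 1) * (cmod z + 1))).
      apply: ler_pM; rewrite ?cmod_ge0 ?lerDl //.
    by rewrite divfK // lt0r_neq0.
  exact: lift_continuous cf fZ Fg.
have [|t t01 ht] := IVT ler01 ch (v := 0).
  rewrite /h rmorph0 rmorph1 mul0r mul1r ge_min le_max (ltW f0) fz orbT //.
move: t01; rewrite in_itv /= => /tr /fn0.
by rewrite -/(h t) ht eqxx.
Unshelve. all: by end_near. Qed.

(** The bound is the filter index [n] itself, so that compactness delivers one [n] valid at all base
    points. *)
Lemma derivative_locally_bounded (p : Pn) :
  \forall p' \near p & n \near \oo, forall (g : C -> Pn) (F : C -> V),
    holomorphic_map (@unit_disc R) g -> (forall z, unit_disc z -> Y (g z)) ->
    local_lift F g 0 -> g 0 = p' ->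
    complex.Re (hform (fubini_study (F 0)) ('D_1 F 0) ('D_1 F 0)) <= n%:R.
Proof.
have [i pi0] : exists i, homog p 0 i != 0.
  apply: contrapT => /forallNP h; have /eqP := homog_neq0 p; apply.
  by apply/rowP => j; rewrite mxE; apply/eqP; have /negP := h j; rewrite negbK.
pose a : V := (homog p 0 i)^-1 *: homog p.
pose f := polydisc_fun a i.
have cf v : v != 0 -> {for v, continuous f} by exact: polydisc_fun_continuous.
have fZ v (c : C) : v != 0 -> c != 0 -> f (c *: v) = f v by exact: polydisc_funZ.
have fp : f (homog p) < 0.
  rewrite /f /polydisc_fun big1 => [|j _]; last first.
    by rewrite mxE mulrA divff // mul1r subrr cmod0.
  by rewrite sub0r mulNr oppr_lt0 divr_gt0 ?cmod_gt0 ?l1norm_gt0 ?homog_neq0.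
have near_neg : \forall p' \near p, f (homog p') < 0.
  have fn : nbhs (f (homog p)) [set x : R | x < 0].
    by apply: (@open_nbhs_nbhs R _ [set x : R | x < 0]); split; [exact: open_lt | exact: fp].
  exact: (homog_continuous cf fZ fn).
have [[A B] /= [pA [n0 _ Bn]] AB] :=
  discs_avoid Xclosed imbedded cf fZ (ltr0_neq0 fp).
pose r : R := n0.+1%:R^-1.
have r0 : 0 < r by rewrite invr_gt0 ltr0n.
have r1 : r <= 1 by rewrite invf_le1 ?ltr0n // ler1n.
(* Sum of the squared Cauchy estimates: on the disc of radius [r] the [j]-th affine coordinate is at
   most [cmod (a 0 j) + 1]. *)
pose K : R := \sum_j (4 * (cmod (a 0 j) + 1) / r) ^+ 2.
exists (A `&` [set p' | f (homog p') < 0], [set n | K <= n%:R]) => /=.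
  split; first exact: filterI.
  by exact: nbhs_infty_ger.
move=> [p' n] [/= [Ap' fp'] Kn] g F hg gY Fg gp; apply: le_trans Kn.
have fg z : cmod z < r -> f (homog (g z)) < 0.
  apply: (disc_stays cf fZ hg r1); last by rewrite gp.
  exact: (AB (p', n0) (conj Ap' (Bn n0 (leqnn n0))) g hg gY gp).
have in_chart z : cmod z < r -> homog (g z) 0 i != 0 /\
    forall j, cmod (affine_coord i j (g z)) <= cmod (a 0 j) + 1.
  by move=> /fg; apply: polydisc_fun_lt0; exact: homog_neq0.
have F0 : F 0 0 i != 0.
  have [_ /coordsP[c c0 ->]] := nbhs_singleton Fg.
  rewrite mxE mulf_neq0 //; apply: (in_chart 0 _).1; by rewrite cmod0.
apply: (le_trans (fubini_study_affine Fg F0)); apply: ler_sum => j _.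
rewrite ler_pXn2r ?nnegrE ?cmod_ge0 //; last first.
  by rewrite divr_ge0 ?(ltW r0) // mulr_ge0 // addr_ge0 ?cmod_ge0.
apply: schwarz_estimate => // z zr; last exact: (in_chart z zr).2.
have [G Gg] := holomorphic_lift hg (lt_le_trans zr r1).
have G0 : G z 0 i != 0.
  have [_ /coordsP[c c0 ->]] := nbhs_singleton Gg.
  by rewrite mxE mulf_neq0 //; exact: (in_chart z zr).1.
by have [] := is_derive_affine_coord j Gg G0.
Qed.

Lemma derivative_bounded : exists B : R, forall (g : C -> Pn) (F : C -> V),
    holomorphic_map (@unit_disc R) g -> (forall z, unit_disc z -> Y (g z)) ->
    local_lift F g 0 ->
    complex.Re (hform (fubini_study (F 0)) ('D_1 F 0) ('D_1 F 0)) <= B.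
Proof.
have [n0 _ H] := Pn_near_covering _ derivative_locally_bounded.
by exists n0%:R => g F hg gY Fg; exact: (H n0 (leqnn n0) (g 0) g F hg gY Fg erefl).
Qed.

End Brody.

(** * Smoothness of the Fubini-Study form *)

Section Smoothness.
Variables (R : realType) (N : nat).
Local Notation C := (Cplx R).
Local Notation V := 'rV[C]_N.+1.
Local Notation W := ('rV[R]_N.+1 * 'rV[R]_N.+1)%type.

(** [S] lists the admissible denominators. The class is closed under directional derivatives as soon
    as derivatives of members of [S] stay in it, which reduces smoothness to an induction. *)
Inductive rational_fun (S : set (W -> R)) : (W -> R) -> Prop :=
| rational_cst c : rational_fun S (cst c)
| rational_fst j : rational_fun S (fun p => p.1 0 j)
| rational_snd j : rational_fun S (fun p => p.2 0 j)
| rational_add f g : rational_fun S f -> rational_fun S g -> rational_fun S (f + g)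
| rational_mul f g : rational_fun S f -> rational_fun S g -> rational_fun S (f * g)
| rational_inv f : S f -> rational_fun S (fun p => (f p)^-1).

Lemma rational_fun_sub (S T : set (W -> R)) f : S `<=` T ->
  rational_fun S f -> rational_fun T f.
Proof. by move=> ST; elim=> *; constructor; rewrite //; exact: ST. Qed.

Definition derivable_in (S : set (W -> R)) (U : set W) (f : W -> R) :=
  (forall p, U p -> {for p, continuous f}) /\
  forall v, exists2 f', rational_fun S f' & forall p, U p -> is_derive p v f (f' p).

Lemma rational_fun_derivable (S : set (W -> R)) (U : set W) f :
  (forall g, S g -> rational_fun S g /\ derivable_in S U g /\ forall p, U p -> g p != 0) ->
  rational_fun S f -> derivable_in S U f.
Proof.
move=> HS; elim=> [c|j|j|g h rg [cg dg] rh [ch dh]|g h rg [cg dg] rh [ch dh]|g Sg].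
- split=> [p _|v]; first exact: cst_continuous.
  by exists (cst 0) => [|p _]; [exact: rational_cst | exact: is_derive_cst].
- have cf p : {for p, continuous (fun p : W => p.1 0 j)}.
    apply: (@continuous_comp _ _ _ fst (fun M : 'rV[R]_N.+1 => M 0 j)); first exact: cvg_fst.
    exact: coord_continuous.
  split=> [p _|v]; first exact: cf.
  exists (cst (v.1 0 j)) => [|p _]; first exact: rational_cst.
  have lin : linear (fun p : W => p.1 0 j) by move=> c x y; rewrite !mxE.
  pose L : {linear W -> R} := HB.pack (fun p : W => p.1 0 j)
     (GRing.isLinear.Build _ _ _ _ _ lin).
  have dL : differentiable L p by apply: linear_differentiable => q; exact: cf.
  apply: DeriveDef; first exact: diff_derivable dL.
  have -> : 'D_v (fun p : W => p.1 0 j) p = 'd L p v := deriveE v dL.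
  by rewrite diff_lin // => q; exact: cf.
- have cf p : {for p, continuous (fun p : W => p.2 0 j)}.
    apply: (@continuous_comp _ _ _ snd (fun M : 'rV[R]_N.+1 => M 0 j)); first exact: cvg_snd.
    exact: coord_continuous.
  split=> [p _|v]; first exact: cf.
  exists (cst (v.2 0 j)) => [|p _]; first exact: rational_cst.
  have lin : linear (fun p : W => p.2 0 j) by move=> c x y; rewrite !mxE.
  pose L : {linear W -> R} := HB.pack (fun p : W => p.2 0 j)
     (GRing.isLinear.Build _ _ _ _ _ lin).
  have dL : differentiable L p by apply: linear_differentiable => q; exact: cf.
  apply: DeriveDef; first exact: diff_derivable dL.
  have -> : 'D_v (fun p : W => p.2 0 j) p = 'd L p v := deriveE v dL.
  by rewrite diff_lin // => q; exact: cf.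
- split=> [p Up|v]; first by apply: continuousD; [exact: cg | exact: ch].
  have [g' rg' Hg] := dg v; have [h' rh' Hh] := dh v.
  exists (g' + h') => [|p Up]; first exact: rational_add.
  exact: is_deriveD (Hg p Up) (Hh p Up).
- split=> [p Up|v]; first by apply: continuousM; [exact: cg | exact: ch].
  have [g' rg' Hg] := dg v; have [h' rh' Hh] := dh v.
  exists (g * h' + h * g') => [|p Up]; first by apply: rational_add; exact: rational_mul.
  exact: is_deriveM (Hg p Up) (Hh p Up).
have [rg [[cg dg] g0]] := HS g Sg.
split=> [p Up|v]; first by apply: continuousV; [exact: g0 | exact: cg].
have [g' rg' Hg] := dg v.
pose i := fun p => (g p)^-1; have ri : rational_fun S i by exact: rational_inv.
exists (cst (-1) * (i * i * g')) => [|p Up].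
  by do 3 (try apply: rational_mul => //); exact: rational_cst.
have [dgp gE] := Hg p Up.
apply: DeriveDef; first exact: derivableV (g0 p Up) dgp.
have -> : (cst (-1) * (i * i * g')) p = -1 * ((g p)^-1 * (g p)^-1 * g' p) by [].
by rewrite (deriveV (g0 p Up) dgp) gE /GRing.scale /= expr2 invfM; ring.
Qed.

(** Stated for [g] agreeing with [f] on [U] only, since the derivative of [g] is known to be
    rational on [U] alone; this is what the induction passes on. *)
Lemma rational_fun_Ck (S : set (W -> R)) (U : set W) k f g : open U ->
  (forall g, S g -> rational_fun S g /\ derivable_in S U g /\ forall p, U p -> g p != 0) ->
  rational_fun S f -> (forall p, U p -> f p = g p) -> Ck k U g.
Proof.
move=> oU HS; elim: k f g => [|k IH] f g rf fg /=.
  move=> p Up; have [cf _] := rational_fun_derivable HS rf.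
  have E : \forall q \near p, f q = g q.
    by apply: filterS (open_nbhs_nbhs (conj oU Up)) => q; exact: fg.
  rewrite /prop_for /continuous_at -(fg p Up).
  exact: cvg_trans (near_eq_cvg E) (cf p Up).
move=> v; have [_ /(_ v)[f' rf' Hf]] := rational_fun_derivable HS rf.
have dg p : U p -> is_derive p v g (f' p).
  move=> Up; apply: near_eq_is_derive (Hf p Up).
  by apply: filterS (open_nbhs_nbhs (conj oU Up)) => q; exact: fg.
split=> [p /dg[] //|]; by apply: IH rf' _ => p /dg[_ ->].
Qed.

Definition sqnorm (p : W) : R := \sum_j (p.1 0 j * p.1 0 j + p.2 0 j * p.2 0 j).

Lemma rational_sqnorm S : rational_fun S sqnorm.
Proof.
have : rational_fun S (fun p => \sum_(j <- index_enum 'I_N.+1)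
   (p.1 0 j * p.1 0 j + p.2 0 j * p.2 0 j)); last by [].
elim: (index_enum _) => [|j r IH].
  have -> : (fun p : W => \sum_(j <- [::]) (p.1 0 j * p.1 0 j + p.2 0 j * p.2 0 j)) = cst 0.
    by apply/funext => p; rewrite big_nil.
  exact: rational_cst.
have -> : (fun p : W => \sum_(j <- j :: r) (p.1 0 j * p.1 0 j + p.2 0 j * p.2 0 j)) =
  ((fun p : W => p.1 0 j) * (fun p : W => p.1 0 j) +
   (fun p : W => p.2 0 j) * (fun p : W => p.2 0 j)) +
  (fun p : W => \sum_(j <- r) (p.1 0 j * p.1 0 j + p.2 0 j * p.2 0 j)).
  by apply/funext => p; rewrite big_cons.
apply: rational_add IH; apply: rational_add; apply: rational_mul; by constructor.
Qed.

Lemma herm_sqnorm p : herm (of_real_coords p) (of_real_coords p) = (sqnorm p)%:C.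
Proof.
rewrite /herm /sqnorm rmorph_sum; apply: eq_bigr => j _; rewrite !mxE.
by apply/eqP; rewrite eq_complex /=; apply/andP; split; apply/eqP; ring.
Qed.

Lemma sqnorm_neq0 p : (sqnorm p != 0) = (of_real_coords p != 0).
Proof.
rewrite -herm_gt0 herm_sqnorm.
have -> : (0 < (sqnorm p)%:C) = (0 < sqnorm p) by rewrite -ltcR.
rewrite lt0r.
suff -> : 0 <= sqnorm p by rewrite andbT.
by apply: sumr_ge0 => j _; rewrite addr_ge0 // -expr2 sqr_ge0.
Qed.

Lemma cone_setT : cone (setT : set (Pn R N)) = [set v | v != 0].
Proof.
apply/seteqP; split => [v [p _ /coords_neq0] //|v /= /coords_ex[p vp]].
by exists p.
Qed.

Lemma fubini_study_smooth (j k : 'I_N.+1) :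
  csmooth_on (cone (setT : set (Pn R N))) (fun v => fubini_study v j k).
Proof.
rewrite cone_setT /csmooth_on.
set U : set W := @of_real_coords R N @^-1` _.
have UE : U = [set p | sqnorm p != 0].
  by apply/funext => p; rewrite /U /preimage /= sqnorm_neq0.
have no_S : forall g : W -> R, set0 g -> rational_fun set0 g /\
   derivable_in set0 U g /\ forall p, U p -> g p != 0 by [].
have no_S' : forall g : W -> R, set0 g -> rational_fun set0 g /\
   derivable_in set0 setT g /\ forall p, setT p -> g p != 0 by [].
have oU : open U.
  rewrite UE; apply: (@open_comp _ _ sqnorm [set x : R | x != 0]); last exact: open_neq.
  by move=> p _; apply: (rational_fun_derivable no_S' (rational_sqnorm _)).1.
pose S : set (W -> R) := [set sqnorm].
have HS g : S g -> rational_fun S g /\ derivable_in S U g /\ forall p, U p -> g p != 0.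
  move=> ->; split; first exact: rational_sqnorm.
  have [c d] := rational_fun_derivable no_S (rational_sqnorm _).
  split; last by move=> p; rewrite UE.
  split=> // v; have [f' rf' Hf] := d v; exists f' => //.
  by apply: rational_fun_sub rf' => ?.
pose i := fun p => (sqnorm p)^-1; have ri : rational_fun S i by exact: rational_inv.
have E p : fubini_study (of_real_coords p) j k =
  (((i p * i p) * (sqnorm p * (j == k)%:R - (p.1 0 j * p.1 0 k + p.2 0 j * p.2 0 k))) +i*
   ((i p * i p) * (p.2 0 j * p.1 0 k - p.1 0 j * p.2 0 k))).
  rewrite mxE herm_sqnorm -rmorphXn /= -fmorphV expr2 invfM -/(i p) !mxE.
  rewrite -(rmorph_nat (real_complex R)).
  by apply/eqP; rewrite eq_complex /=; apply/andP; split; apply/eqP; ring.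
split=> l.
  pose f := (i * i) * (sqnorm * cst (j == k)%:R + cst (-1) *
     ((fun p : W => p.1 0 j) * (fun p : W => p.1 0 k) +
      (fun p : W => p.2 0 j) * (fun p : W => p.2 0 k))).
  apply: (@rational_fun_Ck S U l f _ oU HS) => [|p _].
    by repeat first [exact: ri | exact: rational_sqnorm | apply: rational_add |
      apply: rational_mul | constructor].
  have -> : f p = i p * i p * (sqnorm p * (j == k)%:R + -1 *
    (p.1 0 j * p.1 0 k + p.2 0 j * p.2 0 k)) by [].
  by rewrite E /=; ring.
pose f := (i * i) * ((fun p : W => p.2 0 j) * (fun p : W => p.1 0 k) +
   cst (-1) * ((fun p : W => p.1 0 j) * (fun p : W => p.2 0 k))).
apply: (@rational_fun_Ck S U l f _ oU HS) => [|p _].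
  by repeat first [exact: ri | exact: rational_sqnorm | apply: rational_add |
      apply: rational_mul | constructor].
have -> : f p = i p * i p * (p.2 0 j * p.1 0 k + -1 * (p.1 0 j * p.2 0 k)) by [].
by rewrite E /=; ring.
Qed.

Lemma fubini_study_positive (X : set (Pn R N)) :
  positive_form X (fun v => hform (fubini_study v)).
Proof.
move=> p _; exists setT, (@fubini_study R N); split => //; first exact: openT.
split => [j k|v _ j k|v _|v c vU c0|v a vU].
- exact: fubini_study_smooth.
- exact: fubini_study_hermitian.
- exact: fubini_study_kernel.
- by apply: fubini_studyZ c0; rewrite cone_setT in vU.
- by apply: hform_fubini_study_gt0; rewrite cone_setT in vU.
Qed.

End Smoothness.

(** * Integration over annuli *)

Section Comparison.
Context d (T : measurableType d) (R : realType) (mu : {measure set T -> \bar R}).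
Local Open Scope ereal_scope.

(* Unlike [ge0_le_integral], no measurability: the lower integral is monotone. *)
Lemma integral_le_ge0 (D : set T) (f g : T -> \bar R) :
  (forall x, D x -> 0 <= g x) -> (forall x, D x -> f x <= g x) ->
  \int[mu]_(x in D) f x <= \int[mu]_(x in D) g x.
Proof.
move=> g0 fg; rewrite integralE.
apply: (@le_trans _ _ (\int[mu]_(x in D) f^\+ x)).
  by rewrite geeDl // oppe_le0 integral_ge0.
rewrite !ge0_integralE //; apply: ereal_sup_le => _ [h /= hf <-].
exists h => // x; apply: (le_trans (hf x)); rewrite /patch; case: ifP => // /[1!inE] Dx.
by rewrite funeposE ge_max fg // g0.
Qed.

Lemma integral_le_setT (D : set T) (f g : T -> \bar R) :
  (forall x, 0 <= g x) -> (forall x, D x -> f x <= g x) ->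
  \int[mu]_(x in D) f x <= \int[mu]_x g x.
Proof.
move=> g0 fg; apply: (@le_trans _ _ (\int[mu]_(x in D) g x)); first exact: integral_le_ge0.
rewrite integral_mkcond; apply: integral_le_ge0 => // x _.
by rewrite /patch; case: ifP.
Qed.
End Comparison.

(** * Finite total mass of the pulled-back form and growth of the characteristic *)

Section AnnulusBound.
Variables (R : realType) (N : nat).
Local Notation C := (Cplx R).

(** Telescoping: [1 / (x + b)^2 <= 1 / (x (x + b)) = (1 / x - 1 / (x + b)) / b]. The first term is
    split off, and the induction keeps the telescoped remainder. *)
Lemma sum_inv_sqr_le (l b : R) n : 0 < l -> 0 < b ->
  \sum_(k < n) (l + k%:R * b) ^- 2 <= l ^- 2 + (l * b)^-1.
Proof.
move=> l0 b0.
suff : \sum_(k < n.+1) (l + k%:R * b) ^- 2 <= l ^- 2 + b^-1 * (l^-1 - (l + n%:R * b)^-1).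
  move=> H; rewrite big_ord_recr /= in H.
  have p n' : 0 < l + n'%:R * b by rewrite ltr_wpDr // mulr_ge0 // ltW.
  have q := p n; have h1 : 0 < (l + n%:R * b) ^- 2 by rewrite invr_gt0 exprn_gt0.
  have h2 : 0 < b^-1 * (l + n%:R * b)^-1 by rewrite mulr_gt0 ?invr_gt0.
  have -> : (l * b)^-1 = b^-1 * l^-1 by rewrite invfM mulrC.
  by rewrite mulrBr in H; lra.
elim: n => [|n IH]; first by rewrite big_ord1 mul0r addr0 subrr mulr0 addr0.
rewrite big_ord_recr /=; apply: (le_trans (lerD IH (lexx _))).
have x0 : 0 < l + n%:R * b by rewrite ltr_wpDr // mulr_ge0 // ltW.
have -> : l + n.+1%:R * b = (l + n%:R * b) + b by rewrite -natr1; ring.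
set x := l + n%:R * b in x0 *.
rewrite -addrA lerD2l.
have -> : b^-1 * (l^-1 - (x + b)^-1) = b^-1 * (l^-1 - x^-1) + (x * (x + b))^-1.
  have xb0 : x + b != 0 by rewrite lt0r_neq0 // addr_gt0.
  by field; rewrite xb0 !lt0r_neq0.
have xb : 0 < x + b by rewrite addr_gt0.
have le_sq : x * (x + b) <= (x + b) ^+ 2 by rewrite expr2 ler_pM2r // lerDl ltW.
by rewrite lerD2l lef_pV2 // posrE ?exprn_gt0 // mulr_gt0.
Qed.

Lemma dyadic_shell (r x : R) n : 0 < r -> r < x -> x < r * 2 ^+ n ->
  exists2 k, (k < n)%N & r * 2 ^+ k <= x < r * 2 ^+ k.+1.
Proof.
move=> r0 rx; elim: n => [|n IH xn]; first by rewrite expr0 mulr1 => /(lt_trans rx); rewrite ltxx.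
have [/IH[k kn H]|nx] := ltP x (r * 2 ^+ n); first by exists k => //; exact: ltnW.
by exists n => //; rewrite nx.
Qed.

Local Notation R2 := (measurableTypeR R * measurableTypeR R)%type.

Definition square (s : R) : set R2 := `[- s, s]%classic `*` `[- s, s]%classic.

Lemma measurable_square s : measurable (square s).
Proof. by apply: measurableX; exact: measurable_itv. Qed.

Lemma measure_square (s : R) : 0 < s ->
  ((@lebesgue_measure R) \x (@lebesgue_measure R))%E (square s) = ((2 * s) ^+ 2)%:E.
Proof.
move=> s0.
have itvE : (@lebesgue_measure R) `[- s, s]%classic = (2 * s)%:E.
  by rewrite lebesgue_measure_itv /= lte_fin gtrN // -EFinB opprK mulr2n mulrDl mul1r.
rewrite product_measure1E; [|exact: measurable_itv..].
transitivity ((2 * s)%:E * (2 * s)%:E)%E; last by rewrite -EFinM expr2.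
by congr (_ * _)%E; exact: itvE.
Qed.

Lemma annulus_integral_bounded (f : C -> Pn R N) eta (r0 r1 B : R) :
  0 < r0 -> r0 < r1 -> 0 <= B ->
  (forall z, r0 < cmod z ->
     pullback_density f eta z * (cmod z * ln (cmod z / r0)) ^+ 2 <= B) ->
  exists2 K : R, 0 <= K & forall t, (annulus_integral f eta r1 t <= K%:E)%E.
Proof.
move=> r00 r01 B0 HB.
have r10 : 0 < r1 := lt_trans r00 r01.
pose l : R := ln (r1 / r0); pose b : R := ln 2.
have l0 : 0 < l by rewrite ln_gt0 // ltr_pdivlMr // mul1r.
have b0 : 0 < b by rewrite ln_gt0 // ltr1n.
(* The [k]-th shell lies in a square of side [2 * rho k.+1 = 4 * rho k], of area [16 * rho k ^+ 2].
   The number of shells depends on [t], but the bound on their sum does not. *)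
exists (16 * B * (l ^- 2 + (l * b)^-1)).
  by rewrite mulr_ge0 ?mulr_ge0 // addr_ge0 // invr_ge0 ?exprn_ge0 ?mulr_ge0 // ltW.
move=> t; pose rho k : R := r1 * 2 ^+ k.
have rho0 k : 0 < rho k by rewrite mulr_gt0 // exprn_gt0.
have lk0 k : 0 < l + k%:R * b by rewrite ltr_wpDr // mulr_ge0 // ltW.
pose c k : R := B / (rho k * (l + k%:R * b)) ^+ 2.
have c0 k : 0 <= c k by rewrite divr_ge0 // exprn_ge0 // mulr_ge0 // ltW.
have [n tn] : exists n, t <= rho n.
  exists (Num.truncn (t / r1)).+1; rewrite /rho mulrC -ler_pdivrMr //.
  apply: (ltW (lt_trans (truncnS_gt _) _)).
  by rewrite -natrX ltr_nat; exact: ltn_expl.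
(* Each shell is enlarged to a square, whose product measure is immediate; the resulting loss is
   only a constant factor. *)
pose g k (p : R2) : \bar R := ((c k)%:E * (\1_(square (rho k.+1)) p)%:E)%E.
have g0 k p : (0 <= g k p)%E by rewrite mule_ge0 // lee_fin.
have mg k : measurable_fun setT (g k).
  apply: measurable_funeM; apply/measurable_EFinP.
  exact: measurable_indic (measurable_square _).
apply: (@le_trans _ _ (\int[lebesgue_measure \x lebesgue_measure]_p
    (\sum_(k <- index_enum 'I_n) g k p))%E).
  apply: integral_le_setT => [p|p /= /andP[p1 pt]]; first by apply: sume_ge0.
  have [k kn /andP[k1 k2]] := dyadic_shell r10 p1 (lt_le_trans pt tn).
  rewrite (bigD1 (Ordinal kn)) //=.
  apply: (@le_trans _ _ (g k p)); last by rewrite leeDl // sume_ge0.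
  have -> : g k p = (c k)%:E.
    rewrite /g indicE mem_set ?mule1 //; split; rewrite /= in_itv /= -ler_norml.
      by apply: ltW; apply: le_lt_trans k2; exact: (Re_le_cmod (plane_point p)).
    by apply: ltW; apply: le_lt_trans k2; exact: (Im_le_cmod (plane_point p)).
  set z := plane_point p in p1 pt k1 k2 *.
  rewrite lee_fin /c ler_pdivlMr; last by rewrite exprn_gt0 // mulr_gt0.
  have z0 : 0 < cmod z := lt_trans r10 p1.
  have r0z : r0 < cmod z := lt_trans r01 p1.
  (* The hypothesis bounds the density from above only; a negative value has to be treated apart
     before enlarging the other factor. *)
  have [d0|d0] := ltP (pullback_density f eta z) 0.
    apply: le_trans B0; apply: mulr_le0_ge0; first exact: ltW.
    by rewrite exprn_ge0 // mulr_ge0 // ltW.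
  apply: le_trans (HB _ r0z); apply: ler_wpM2l => //.
  rewrite ler_pXn2r ?nnegrE; first last.
  - by rewrite mulr_ge0 ?(ltW z0) // ln_ge0 // ler_pdivlMr // mul1r ltW.
  - by rewrite mulr_ge0 // ltW.
  - by [].
  apply: ler_pM => //; try exact: ltW.
  have -> : l + k%:R * b = ln (rho k / r0).
    rewrite /l /b mulr_natl -lnXn // -lnM ?posrE ?divr_gt0 ?exprn_gt0 //.
    by congr ln; rewrite /rho mulrAC.
  by rewrite ler_ln ?posrE ?divr_gt0 // ler_pM2r ?invr_gt0.
rewrite ge0_integral_sum //.
rewrite (eq_bigr (fun k : 'I_n => (16 * B * (l + k%:R * b) ^- 2)%:E)) => [|k _].
  rewrite sumEFin lee_fin -mulr_sumr ler_wpM2l //; first by rewrite mulr_ge0.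
  exact: sum_inv_sqr_le.
have mi : measurable_fun setT (EFin \o (\1_(square (rho k.+1)) : R2 -> R)).
  by apply/measurable_EFinP; exact: measurable_indic (measurable_square _).
have i0 (p : R2) : setT p -> (0 <= (EFin \o (\1_(square (rho k.+1)) : R2 -> R)) p)%E.
  by move=> _; rewrite lee_fin.
rewrite (ge0_integralZl_EFin (lebesgue_measure \x lebesgue_measure)%E measurableT i0 mi (c0 k)) /=.
rewrite integral_indic //; last exact: measurable_square.
rewrite setIT; transitivity ((c k)%:E * ((2 * rho k.+1) ^+ 2)%:E)%E.
  by congr (_ * _)%E; exact: measure_square.
rewrite -EFinM; congr EFin.
rewrite /c /rho (exprS 2 k); have := lk0 k; set x := l + _ => x0.
by field; rewrite !lt0r_neq0 // exprn_gt0.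
Qed.

(** Enlarging the range of [t] from [[r1, r]] to [[1, r]] makes the majorant [K / t] integrate to
    exactly [K * ln r]. *)
Lemma characteristic_bounded (f : C -> Pn R N) eta (r1 K : R) : 1 <= r1 -> 0 <= K ->
  (forall t, (annulus_integral f eta r1 t <= K%:E)%E) ->
  forall r, 1 < r -> (characteristic f eta r r1 <= (K * ln r)%:E)%E.
Proof.
move=> r11 K0 HK r r_gt1.
have -> : (K * ln r)%:E = (\int[lebesgue_measure]_(t in `[1%R, r]) (K * t^-1)%:E)%E.
  rewrite (@continuous_FTC2 R (fun t => K * t^-1) (fun t => K * ln t)) //.
  - by rewrite ln1 mulr0 sube0.
  - apply: continuous_in_subspaceT => t; rewrite inE /= in_itv /= => /andP[t1 _].
    apply: continuousM; first exact: cst_continuous.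
    by apply: inv_continuous; rewrite lt0r_neq0 // (lt_le_trans ltr01).
  - have cl (t : R) : 0 < t -> {for t, continuous (fun t => K * ln t)}.
      move=> t0; apply: continuousM; first exact: cst_continuous.
      exact: continuous_ln.
    split=> [t | |].
    + rewrite in_itv /= => /andP[t1 _]; apply: derivableZ.
      by have [] := is_derive1_ln (lt_trans ltr01 t1).
    + by apply: cvg_at_right_filter; exact: cl.
    + by apply: cvg_at_left_filter; apply: cl; exact: lt_trans r_gt1.
  - move=> t; rewrite in_itv /= => /andP[t1 _].
    have [dl dE] := is_derive1_ln (lt_trans ltr01 t1).
    rewrite derive1E; have -> : (fun t => K * ln t) = K \*: (@ln R) by [].
    by rewrite deriveZ // dE.
rewrite /characteristic [leRHS]integral_mkcond.
apply: integral_le_setT => [t|t].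
  rewrite /patch; case: ifP => //; rewrite inE /= in_itv /= => /andP[t1 _].
  by rewrite lee_fin mulr_ge0 // invr_ge0 (le_trans ler01).
rewrite /= in_itv /= => /andP[t1 tr].
have t1' : 1 <= t := le_trans r11 t1.
rewrite /patch ifT; last by rewrite inE /= in_itv /= t1' tr.
rewrite EFinM lee_wpmul2r // lee_fin invr_ge0.
exact: le_trans t1'.
Qed.

End AnnulusBound.

(** * Pull-back estimate and conclusion *)

Section Pullback.
Variables (R : realType) (N : nat).
Local Notation C := (Cplx R).
Local Notation V := 'rV[C]_N.+1.
Local Notation Pn := (Pn R N).

Lemma local_lift_near (F : C -> V) (f : C -> Pn) z :
  local_lift F f z -> \forall w \near z, local_lift F f w.
Proof. by move=> Ff; apply: near_join. Qed.

Lemma derivable_row (F : C -> V) (z : C) :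
  (forall j, derivable (fun w => F w 0 j) z 1) -> derivable F z 1.
Proof.
move=> dF.
have -> : F = \sum_(j < N.+1) (fun w => F w 0 j *: (delta_mx 0 j : V)).
  apply/funext => w; rewrite fct_sumE [LHS]row_sum_delta; exact: eq_bigr.
apply: derivable_sum => j; apply/derivable1_diffP.
by apply: differentiableZl; apply/derivable1_diffP.
Qed.

(** Normalising one coordinate to 1 removes the arbitrariness of [homog]: the entries become affine
    coordinates, which are holomorphic by comparison with any local lift. *)
Lemma chart_lift_local (f : C -> Pn) z :
  (exists F : C -> V, local_lift F f z) -> local_lift (chart_lift f z) f z.
Proof.
move=> [F Ff]; rewrite /chart_lift; set i := odflt _ _.
have hi : homog (f z) 0 i != 0.
  rewrite /i; case: pickP => [//|h]; have /eqP := homog_neq0 (f z); case.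
  by apply/rowP => j; rewrite mxE; apply/eqP; have := h j; rewrite /= => /negbFE.
have [dF Fz] := nbhs_singleton Ff.
have Fi : F z 0 i != 0.
  by have /coordsP[c c0 ->] := Fz; rewrite mxE mulf_neq0.
have Fin : \forall w \near z, F w 0 i != 0.
  have [di _] := is_derive_coord i dF.
  have cF : {for z, continuous (fun w => F w 0 i)}.
    by apply: differentiable_continuous; apply/derivable1_diffP.
  have o : nbhs (F z 0 i) [set u : C | u != 0].
    apply/near_cmodP; exists (cmod (F z 0 i)); first by rewrite cmod_gt0.
    by move=> w; apply: contraTneq => ->; rewrite sub0r cmodN ltxx.
  exact: cF o.
apply: filterS3 Fin Ff (local_lift_near Ff) => w Fwi [dFw Fw] Ffw.
have hw : homog (f w) 0 i != 0.
  by have /coordsP[c c0 E] := Fw; move: Fwi; rewrite E mxE mulf_eq0 negb_or => /andP[].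
split; last by apply: coordsZ (coords_homog _); rewrite invr_eq0.
apply: derivable_row => j.
have [d _] := is_derive_affine_coord j Ffw Fwi.
have -> : (fun w => ((homog (f w) 0 i)^-1 *: homog (f w)) 0 j) =
    fun w => affine_coord i j (f w).
  by apply/funext => u; rewrite mxE mulrC.
exact: d.
Qed.

Lemma local_lift_comp (F : C -> V) (f : C -> Pn) (g : C -> C) z :
  (forall w, derivable g w 1) -> local_lift F f (g z) ->
  local_lift (fun w => F (g w)) (fun w => f (g w)) z.
Proof.
move=> dg Ff.
have cg : {for z, continuous g}.
  by apply: differentiable_continuous; apply/derivable1_diffP.
have : \forall w \near z, derivable F (g w) 1 /\ coords (F (g w)) (f (g w)) := cg _ Ff.
apply: filterS => w [dF Fw]; split; last exact: Fw.
by have [] := is_derive1_chain (derivableP (dg w)) (derivableP dF).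
Qed.

Lemma is_derive_exp_disc (z0 L z : C) :
  is_derive z (1 : C) (fun w => z0 * cexp (L * w)) (z0 * (L * cexp (L * z))).
Proof.
have dL : is_derive z (1 : C) (fun w => L * w) L.
  have [d E] := is_deriveZ L (is_derive_id z (1 : C)).
  by apply: DeriveDef; [exact: d | rewrite [LHS]E /GRing.scale /= mulr1].
have de := is_derive1_chain dL (is_derive_cexp (L * z)).
by have [d E] := is_deriveZ z0 de; apply: DeriveDef; [exact: d | exact: E].
Qed.

Lemma pullback_density_le (Y : set Pn) (B r0 : R) (f : C -> Pn) :
  (forall (g : C -> Pn) (F : C -> V),
    holomorphic_map (@unit_disc R) g -> (forall z, unit_disc z -> Y (g z)) ->
    local_lift F g 0 ->
    complex.Re (hform (fubini_study (F 0)) ('D_1 F 0) ('D_1 F 0)) <= B) ->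
  0 < r0 -> holomorphic_map (@exterior R r0) f ->
  (forall z, exterior r0 z -> Y (f z)) ->
  forall z, r0 < cmod z ->
    pullback_density f (fun v => hform (fubini_study v)) z *
      (cmod z * ln (cmod z / r0)) ^+ 2 <= B.
Proof.
move=> HB r00 hf fY z0 z0r.
pose L : R := ln (cmod z0 / r0).
have z00 : 0 < cmod z0 := lt_trans r00 z0r.
have L0 : 0 < L by rewrite ln_gt0 // ltr_pdivlMr // mul1r.
pose g (w : C) : C := z0 * cexp (L%:C * w).
have dg w := is_derive_exp_disc z0 L%:C w.
have gE z : unit_disc z -> exterior r0 (g z).
  rewrite /unit_disc /exterior /= => z1; rewrite cmodM cmod_cexp /=.
  (* [Re w > -1] on the unit disc, so this choice of [L] keeps the image exactly outside the radius
     [r0]. *)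
  have -> : r0 = cmod z0 * expR (- L).
    by rewrite expRN lnK ?posrE ?divr_gt0 // invf_div mulrCA divff ?mulr1 ?lt0r_neq0.
  rewrite ltr_pM2l // ltr_expR.
  have := Re_le_cmod z; rewrite ler_norml => /andP[zl _].
  have -> : complex.Re (L%:C * z) = L * complex.Re z.
    by case: (z) => x y /=; rewrite mul0r subr0.
  by rewrite -mulrN1 ltr_pM2l //; lra.
have g0 : g 0 = z0 by rewrite /g mulr0 cexp0 mulr1.
pose F := chart_lift f z0.
have Ff : local_lift F f z0.
  by apply: chart_lift_local; have [F0 HF0] := hf z0 z0r; exists F0.
have dgw w : derivable g w 1 by have [] := dg w.
have lift0 : local_lift (fun w => F (g w)) (fun w => f (g w)) 0.
  by apply: (@local_lift_comp F f g 0 dgw); rewrite g0; exact: Ff.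
have hol : holomorphic_map (@unit_disc R) (fun w => f (g w)).
  move=> z /gE /hf[G HG]; exists (fun w => G (g w)).
  exact: (@local_lift_comp G f g z dgw HG).
have := HB _ _ hol (fun z zd => fY _ (gE z zd)) lift0.
have [dF _] := nbhs_singleton Ff.
have dFg : is_derive (g 0) (1 : C) F ('D_1 F z0) by rewrite g0; exact: derivableP.
have [_ ->] := is_derive1_chain (dg 0) dFg.
rewrite g0 mulr0 cexp0 mulr1; set c := z0 * _.
have hc v a : hform (fubini_study v) (c *: a) (c *: a) =
    `|c| ^+ 2 * hform (fubini_study v) a a.
  by rewrite !hform_fubini_study !(hermZl, hermZr) normCK; ring.
rewrite hc normC_cmod -rmorphXn /=.
have ReM (x : R) (w : C) : complex.Re (x%:C * w) = x * complex.Re w.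
  by case: (w) => a b /=; rewrite mul0r subr0.
rewrite ReM mulrC /pullback_density -/F derive1E.
have -> : cmod c = cmod z0 * L by rewrite /c cmodM cmod_real gtr0_norm.
by [].
Qed.

End Pullback.

Theorem theorem1p1 (R : realType) (N : nat) (X : set (Pn R N))
    (hX : projective_variety X) (D : effective_cartier_divisor X) :
  hyperbolically_imbedded X (cartier_support D) ->
  quantitatively_big_picard X (cartier_support D).
Proof.
move=> imb r0 f r01 hf fY.
have [Xalg _ _] := hX.
have [B HB] := derivative_bounded (algebraic_closed Xalg) imb.
exists (fun v => hform (fubini_study v)); first exact: fubini_study_positive.
move=> r1 r01'.
have r00 : 0 < r0 := lt_le_trans ltr01 r01.
(* The disc bound [B] comes without a sign, whereas the mass estimate multiplies a nonnegative
   constant. *)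
have B0 : 0 <= Num.max B 0 by rewrite le_max lexx orbT.
have HB' z : r0 < cmod z -> pullback_density f (fun v => hform (fubini_study v)) z *
    (cmod z * ln (cmod z / r0)) ^+ 2 <= Num.max B 0.
  move=> zr; apply: (le_trans (pullback_density_le HB r00 hf fY zr)).
  by rewrite le_max lexx.
have [K K0 HK] := annulus_integral_bounded r00 r01' B0 HB'.
exists K, set0; split; first exact: measurable0.
  by rewrite measure0.
move=> r r1r _; apply: characteristic_bounded => //.
  by apply: ltW; exact: le_lt_trans r01'.
by apply: lt_le_trans r1r; exact: le_lt_trans r01'.
Qed.
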